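(* Let $1<n<+\infty$ and let $(X,\mathsf d,\mathfrak m)$ be a $\mathsf{CD}(0,n)$ space. Then for any $f\in BV(X,\mathsf d,\mathfrak m)$ it holds $$n\,\omega_n^{\frac1n}\,\mathrm{AVR}(X,\mathsf d,\mathfrak m)^{\frac1n}\left(\int_X|f|^{\frac{n}{n-1}}\,d\mathfrak m\right)^{\frac{n-1}{n}}\le |Df|(X).$$ In particular, for any set of finite perimeter $E\subset X$ with $\mathfrak m(E)<\infty$, $$P(E)\ \ge\ n\,\omega_n^{\frac1n}\,\mathrm{AVR}(X,\mathsf d,\mathfrak m)^{\frac1n}\,\mathfrak m(E)^{\frac{n-1}{n}}.$$
   Context: A metric measure space $(X,\mathsf d,\mathfrak m)$ is a complete, locally compact, separable metric space with a Borel measure $\mathfrak m$ that is finite on bounded sets and has support $X$. $\mathsf{CD}(0,n)$ (Lott–Sturm–Villani; $n$ need not be an integer): for every pair of boundedly supported probability measures $\mu_0,\mu_1\ll\mathfrak m$ there is a $W_2$-geodesic $(\mu_t)_{t\in[0,1]}$ joining them such that $S_{n'}(\mu_t)\le(1-t)S_{n'}(\mu_0)+tS_{n'}(\mu_1)$ for all $t\in[0,1]$ and all $n'\ge n$, where $S_{n'}(\mu)=-\int_X\rho^{1-1/n'}\,d\mathfrak m$ and $\rho$ is the density of the absolutely continuous part of $\mu$ with respect to $\mathfrak m$. $\omega_n=\pi^{n/2}/\Gamma(n/2+1)$ and $\mathrm{AVR}(X,\mathsf d,\mathfrak m)=\lim_{r\to+\infty}\frac{\mathfrak m(B_r(x))}{\omega_nr^n}$,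 which exists and is independent of $x\in X$ by Bishop–Gromov monotonicity. The slope of $u$ is $\mathrm{lip}\,u(x)=\limsup_{y\to x}\frac{|u(y)-u(x)|}{\mathsf d(x,y)}$ ($0$ at isolated points). A function $f\in L^1(X,\mathfrak m)$ belongs to $BV(X,\mathsf d,\mathfrak m)$ if there are locally Lipschitz $f_i\to f$ in $L^1(X,\mathfrak m)$ with $\limsup_i\int_X\mathrm{lip}\,f_i\,d\mathfrak m<+\infty$; then $|Df|(X)=\inf\{\liminf_i\int_X\mathrm{lip}\,f_i\,d\mathfrak m: f_i\in \mathrm{Lip}_{\rm loc}(X),\ f_i\to f\text{ in }L^1(X,\mathfrak m)\}$. For a Borel set $E$, $P(E)=\inf\{\liminf_i\int_X\mathrm{lip}\,u_i\,d\mathfrak m: u_i\in\mathrm{Lip}_{\rm loc}(X),\ u_i\to\chi_E\text{ in }L^1_{\rm loc}(X,\mathfrak m)\}$, and $E$ has finite perimeter if $P(E)<+\infty$. *)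

(* Defs.v *)
From HB Require Import structures.
From mathcomp Require Import all_boot all_order all_algebra.
From mathcomp Require Import all_classical all_reals all_analysis.

Set Implicit Arguments.
Unset Strict Implicit.
Unset Printing Implicit Defensive.

Import Order.TTheory GRing.Theory Num.Theory.
Import numFieldNormedType.Exports.

Local Open Scope classical_set_scope.
Local Open Scope ring_scope.

(* [Complete] carries a distinguished point, as does every measurableType;
   the only effect is that the spaces are nonempty. *)
#[short(type="completeMetricType")]
HB.structure Definition CompleteMetric (R : realType) :=
  {T of Complete T & Metric R T}.

Definition borel (R : realType) (X : completeMetricType R) :=
  g_sigma_algebraType (@open X).

Section metric_measure_spaces.
Context {R : realType} {X : completeMetricType R}.
Implicit Types (m : {measure set (borel X) -> \bar R}).
Local Open Scope ereal_scope.

Definition mbounded (A : set X) := exists x r, A `<=` ball x r.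

Definition separable := exists2 D : set X, countable D & dense D.

Definition msupport m : set X :=
  [set x | forall U : set X, open U -> U x -> 0 < m U].

Definition metric_measure_space m :=
  [/\ locally_compact [set: X], separable,
      forall A : set (borel X), measurable A -> mbounded A -> m A < +oo &
      msupport m = setT].

End metric_measure_spaces.
Arguments separable {R} X.

Section wasserstein.
Context {R : realType} {X : completeMetricType R}.
Implicit Types mu nu : probability (borel X) R.
Local Open Scope ereal_scope.

(* On a separable space the product sigma-algebra of [borel X * borel X] is
   the Borel sigma-algebra of the product, and [mdist] is measurable for it. *)
Definition coupling mu nu
    (g : {measure set (borel X * borel X)%type -> \bar R}) :=
  forall A : set (borel X), measurable A ->
    g (A `*` setT) = mu A /\ g (setT `*` A) = nu A.

Definition W2 mu nu : \bar R :=
  ereal_inf [set c | exists2 g : {measure set (borel X * borel X)%type -> \bar R},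
    coupling mu nu g & c = \int[g]_p (mdist (p.1 : X) (p.2 : X) ^+ 2)%:E]
  `^ 2^-1.

Definition W2_geodesic (mu_ : R -> probability (borel X) R) :=
  forall s t, (0 <= s <= 1)%R -> (0 <= t <= 1)%R ->
    W2 (mu_ s) (mu_ t) = `|t - s|%:E * W2 (mu_ 0%R) (mu_ 1%R).

(* Equality of measures is tested on measurable sets only: the values on other
   sets are meaningless. *)
Definition joins (mu_ : R -> probability (borel X) R) mu nu :=
  forall A : set (borel X), measurable A ->
    mu_ 0%R A = mu A /\ mu_ 1%R A = nu A.

End wasserstein.

Section curvature_dimension.
Context {R : realType} {X : completeMetricType R}.
Implicit Types (m : {measure set (borel X) -> \bar R}).
Implicit Types mu : probability (borel X) R.
Local Open Scope ereal_scope.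

(* [rho] comes from a Lebesgue decomposition mu = rho m + nu, where nu and m
   are mutually singular. *)
Definition is_ac_density m mu (rho : borel X -> R) :=
  [/\ measurable_fun setT rho, forall x, (0 <= rho x)%R &
      exists nu : {measure set (borel X) -> \bar R},
        (exists N, [/\ measurable N, m N = 0 & nu (~` N) = 0]) /\
        forall A, measurable A -> mu A = \int[m]_(x in A) (rho x)%:E + nu A].

(* Such a density exists when m is sigma-finite, and is unique m-a.e. *)
Definition ac_density m mu : borel X -> R :=
  xget (cst 0%R) (is_ac_density m mu).

Definition renyi_entropy m (n : R) mu : \bar R :=
  - \int[m]_x (ac_density m mu x `^ (1 - n^-1))%:E.

Definition CD0 m (n : R) :=
  forall mu0 mu1 : probability (borel X) R,
    mbounded (msupport mu0) -> mbounded (msupport mu1) ->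
    mu0 `<< m -> mu1 `<< m ->
    exists mu_ : R -> probability (borel X) R,
      [/\ W2_geodesic mu_, joins mu_ mu0 mu1 &
          forall t n', (0 <= t <= 1)%R -> (n <= n')%R ->
            renyi_entropy m n' (mu_ t) <=
              (1 - t)%:E * renyi_entropy m n' mu0 +
              t%:E * renyi_entropy m n' mu1].

End curvature_dimension.

Section asymptotic_volume_ratio.
Context {R : realType}.

Definition Gamma (z : R) : R :=
  \int[lebesgue_measure]_(t in `]0, +oo[) (t `^ (z - 1) * expR (- t)).

Definition omega (n : R) : R := pi `^ (n / 2) / Gamma (n / 2 + 1).

Definition AVR {X : completeMetricType R}
    (m : {measure set (borel X) -> \bar R}) (n : R) (x : X) : \bar R :=
  lim ((m (ball x r) * (omega n * r `^ n)^-1%:E)%E @[r --> +oo%R]).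

End asymptotic_volume_ratio.

Section bounded_variation.
Context {R : realType} {X : completeMetricType R}.
Implicit Types (m : {measure set (borel X) -> \bar R}).
Local Open Scope ereal_scope.

(* At an isolated point [x^'] is the improper filter, on which [limf_esup] is
   -oo, whence the case distinction. *)
Definition slope (u : X -> R) (x : X) : \bar R :=
  if `[< isolated [set: X] x >] then 0
  else limf_esup (fun y => (`|u y - u x| / mdist x y)%:E) x^'.

Definition locally_lipschitz (u : X -> R) :=
  forall x : X, exists2 U : set X, nbhs x U &
    exists L : R, forall y z, U y -> U z -> (`|u y - u z| <= L * mdist y z)%R.

Definition slope_energy m (u : X -> R) : \bar R :=
  \int[m]_(x in [set: borel X]) slope u x.

Definition L1 m (f : X -> R) :=
  m.-integrable [set: borel X] (fun x => (f x)%:E).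

Definition cvg_L1 m (f_ : (X -> R)^nat) (f : X -> R) :=
  (forall i, L1 m (f_ i)) /\
  \int[m]_(x in [set: borel X]) `|f_ i x - f x|%:E @[i --> \oo] --> 0.

Definition cvg_L1loc m (f_ : (X -> R)^nat) (f : X -> R) :=
  forall K : set X, compact K ->
    (forall i, m.-integrable (K : set (borel X)) (fun x => (f_ i x)%:E)) /\
    \int[m]_(x in (K : set (borel X))) `|f_ i x - f x|%:E @[i --> \oo] --> 0.

Definition BV m (f : X -> R) :=
  L1 m f /\
  exists f_ : (X -> R)^nat, [/\ forall i, locally_lipschitz (f_ i),
    cvg_L1 m f_ f & limn_esup (fun i => slope_energy m (f_ i)) < +oo].

Definition bv_variation m (f : X -> R) : \bar R :=
  ereal_inf [set c | exists f_ : (X -> R)^nat,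
    [/\ forall i, locally_lipschitz (f_ i), cvg_L1 m f_ f &
        c = limn_einf (fun i => slope_energy m (f_ i))]].

Definition perimeter m (E : set X) : \bar R :=
  ereal_inf [set c | exists u_ : (X -> R)^nat,
    [/\ forall i, locally_lipschitz (u_ i), cvg_L1loc m u_ \1_E &
        c = limn_einf (fun i => slope_energy m (u_ i))]].

End bounded_variation.

(* Main.v *)
Require Import Defs.
From HB Require Import structures.
From mathcomp Require Import all_boot all_order all_algebra.
From mathcomp Require Import all_classical all_reals all_analysis.
From mathcomp Require Import measurable_realfun.
From mathcomp Require Import ring lra.

Set Implicit Arguments.
Unset Strict Implicit.
Unset Printing Implicit Defensive.

Import Order.TTheory GRing.Theory Num.Theory.
Import numFieldNormedType.Exports.

Local Open Scope classical_set_scope.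
Local Open Scope ring_scope.
Local Open Scope ereal_scope.

(** A Sobolev inequality by optimal transport to large balls. For u >= 0
    locally Lipschitz with bounded support and p = n/(n-1), Z = \int u^p,
    apply CD(0,n) to the probability measures u^p/Z m and the uniform measure on
    B_r(x0), at time t = eps/(r0 + r + 1) where B_r0(x0) contains the support of
    u. Along the geodesic, mass is displaced by less than eps up to an
    arbitrarily small error, so the tangent line of s |-> s^(1-1/n) at
    (sup_{B_eps(x)} u)^p/Z bounds the entropy at time t; letting r -> oo, where
    m(B_r(x0)) >= c r^n, gives
      n c^(1/n) Z^(1-1/n) <= \int (sup_{B_eps(x)} u - u)/eps dm,
    and eps -> 0 gives the integral of the slope. The dominating function uses
    that closed balls are compact, which follows from CD(0,n) through the
    existence of approximate intermediate points (Hopf-Rinow). Cutting off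
    removes the support condition, truncation gives the lower semicontinuity
    under L^1_loc convergence, and c tends to omega_n AVR. *)

(** * Measures with density and gluing of couplings *)

(** The exponents make everything linear in u. Since p (1 - 1/n) = 1, the entropy of u^p/Z is a
    multiple of \int u. The tangent line at u^p/Z has a slope proportional to u^(-1/(n-1)), and this
    weight integrates against u^p/Z to (\int u)/Z. The terms of order zero therefore cancel in the
    entropy inequality. Up to t \int u, there remain t m(B_r)^(1/n) Z^(1-1/n), which is about eps
    c^(1/n) Z^(1-1/n), and 1/n times the increase of \int u; hence the factor n.

    The obstacle is that a W_2-geodesic is only a curve of measures: neither an optimal plan, nor
    geodesics of points, nor absolute continuity at intermediate times is given. The displacement is
    read off from nearly optimal plans between the times 0, t and 1: near equality in the convexity
    inequality for the squared distance forces almost all mass to move at most t times the largest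
    distance between the two supports, plus a small excess. A singular part at time t is harmless
    because the slope of the tangent line is nonnegative, so it can only enlarge the integral being
    transported. *)

Section density.
Context d (T : measurableType d) (R : realType).
Variables (mu : {measure set T -> \bar R}) (f : T -> R).

(** The two proofs are arguments so that the measure structure, which rests on both, can be attached
    to the term itself. *)
Definition mdensity (mf : measurable_fun setT f) (f0 : forall x, (0 <= f x)%R) :=
  fun A : set T => \int[mu]_(x in A) (f x)%:E.

Hypotheses (mf : measurable_fun setT f) (f0 : forall x, (0 <= f x)%R).

Let mdensity0 : mdensity mf f0 set0 = 0.
Proof. exact: integral_set0. Qed.

Let mdensity_ge0 A : 0 <= mdensity mf f0 A.
Proof. by apply: integral_ge0 => x _; rewrite lee_fin. Qed.

Let mdensity_sigma_additive : semi_sigma_additive (mdensity mf f0).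
Proof.
move=> F mF tF mUF; rewrite /mdensity ge0_integral_bigcup//=; last 2 first.
- exact/measurable_EFinP/measurable_funTS.
- by move=> x _; rewrite lee_fin.
by apply: is_cvg_nneseries => n _ _; apply: integral_ge0 => x _; rewrite lee_fin.
Qed.

HB.instance Definition _ := isMeasure.Build _ _ _ (mdensity mf f0)
  mdensity0 mdensity_ge0 mdensity_sigma_additive.

Import HBNNSimple.

Let integral_mdensity_nnsfun (h : {nnsfun T >-> R}) :
  \int[mdensity mf f0]_x (h x)%:E = \int[mu]_x ((h x)%:E * (f x)%:E).
Proof.
transitivity (\sum_(k \in range h)
    \int[mu]_x ((k * \1_(h @^-1` [set k]) x)%:E * (f x)%:E)).
  under eq_integral do rewrite fimfunE -fsumEFin//.
  rewrite ge0_integral_fsum//; last 2 first.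
  - by move=> y; exact/measurable_EFinP/measurable_funM.
  - by move=> y x _; rewrite nnfun_muleindic_ge0.
  apply: eq_fsbigr => r /[!inE] -[x _ <-].
  rewrite integralZl_indic_nnsfun// integral_indic// setIT.
  under [RHS]eq_integral do rewrite EFinM -muleA.
  rewrite ge0_integralZl//; last 3 first.
  - by apply: emeasurable_funM; exact/measurable_EFinP.
  - by move=> y _; rewrite mule_ge0// lee_fin.
  - by rewrite lee_fin.
  congr (_ * _); rewrite /= /mdensity [LHS]integral_mkcond epatch_indic.
  by apply: eq_integral => y _; rewrite muleC.
rewrite -ge0_integral_fsum//.
- apply: eq_integral => x _; rewrite [in RHS]fimfunE -fsumEFin//.
  rewrite ge0_mule_fsuml// => r.
  by rewrite nnfun_muleindic_ge0.
- move=> r; apply: emeasurable_funM; apply/measurable_EFinP => //.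
  exact/measurable_funM.
- by move=> r x _; rewrite mule_ge0 ?lee_fin// -lee_fin EFinM
    nnfun_muleindic_ge0.
Qed.

Lemma integral_mdensity (g : T -> \bar R) : measurable_fun setT g ->
  (forall x, 0 <= g x) ->
  \int[mdensity mf f0]_x g x = \int[mu]_x (g x * (f x)%:E).
Proof.
move=> mg g0; pose h := nnsfun_approx measurableT mg.
transitivity (limn (fun n => \int[mdensity mf f0]_x (h n x)%:E)).
  rewrite -monotone_convergence//.
  - apply: eq_integral => y _; apply/esym/cvg_lim => //.
    exact: cvg_nnsfun_approx.
  - by move=> n; exact/measurable_EFinP/measurable_funP.
  - by move=> n y _; rewrite lee_fin.
  - by move=> y _ m n mn; rewrite lee_fin; exact/lefP/nd_nnsfun_approx.
under eq_fun do rewrite integral_mdensity_nnsfun.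
rewrite -monotone_convergence//.
- apply: eq_integral => y _; apply/cvg_lim => //.
  apply: cvgeZr => //.
  exact: cvg_nnsfun_approx.
- by move=> n; apply: emeasurable_funM; exact/measurable_EFinP.
- by move=> n y _; rewrite mule_ge0// lee_fin.
- move=> y _ m n mn; apply: lee_wpmul2r; rewrite lee_fin//.
  exact/lefP/nd_nnsfun_approx.
Qed.

End density.

(** * Gluing of two measures along countable partitions *)

Section gluing.
Context d1 d2 (U : measurableType d1) (V : measurableType d2) (R : realType).
Variables (g1 : {finite_measure set U -> \bar R}).
Variables (g2 : {finite_measure set V -> \bar R}).
Variables (a : U -> nat) (b : V -> nat).
Hypothesis ma : forall n, measurable (a @^-1` [set n]).
Hypothesis mb : forall n, measurable (b @^-1` [set n]).
Hypothesis ab : forall n, g1 (a @^-1` [set n]) = g2 (b @^-1` [set n]).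

(** [k] is a density with respect to [g1 \x g2]: on each pair of classes with the same label it is
    the product, normalized by the common mass of the two classes. On classes of mass zero the
    convention 0^-1 = 0 makes it vanish. *)
Let c n : R := fine (g2 (b @^-1` [set n])).
Let S : set (U * V) := [set p | a p.1 = b p.2].
Let k (p : U * V) : R := \1_S p * (c (b p.2))^-1.

Let mS : measurable S.
Proof.
rewrite (_ : S = \bigcup_n (a @^-1` [set n] `*` b @^-1` [set n])).
  by apply: bigcupT_measurable => n; exact: measurableX.
apply/seteqP; split=> [[x y]/= Sxy|[x y]/= [n _ [/= an bn]]].
  by exists (a x) => //; split.
by rewrite /S/= an bn.
Qed.

Let cE n : (c n)%:E = g2 (b @^-1` [set n]).
Proof. by rewrite fineK// fin_num_measure. Qed.

Let mcb : measurable_fun setT (fun v => (c (b v))^-1%R).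
Proof.
move=> _ Y mY; rewrite setTI.
rewrite (_ : _ @^-1` _ =
  \bigcup_(n in [set n | Y (c n)^-1%R]) b @^-1` [set n]); last first.
  by apply/seteqP; split=> [v/= Yv|v/= [n /= Yn ->//]]; exists (b v).
exact: bigcup_measurable.
Qed.

Let mk : measurable_fun setT k.
Proof.
apply: measurable_funM; first exact: measurable_indic.
exact: (measurableT_comp mcb measurable_snd).
Qed.

Let k0 p : (0 <= k p)%R.
Proof. by rewrite mulr_ge0// invr_ge0 fine_ge0. Qed.

Let mkE : measurable_fun setT (EFin \o k).
Proof. exact/measurable_EFinP. Qed.

Let k1 u : c (a u) != 0%R -> \int[g2]_v (k (u, v))%:E = 1.
Proof.
move=> ca; rewrite (eq_integral
    (fun v => ((c (a u))^-1)%:E * (\1_(b @^-1` [set a u]) v)%:E)); last first.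
  move=> v _; rewrite -EFinM /k mulrC/= /S !indicE/=; congr (_%:E).
  have [buv|buv] := eqVneq (b v) (a u).
    by rewrite !mem_set// buv.
  by rewrite !memNset/= ?mulr0//; [exact/eqP|move/esym; exact/eqP].
rewrite ge0_integralZl//=; last 2 first.
- by apply/measurable_EFinP; exact: measurable_indic.
- by rewrite lee_fin invr_ge0 fine_ge0.
rewrite integral_indic// setIT [X in _ * X](_ : _ = (c (a u))%:E).
  by rewrite -EFinM mulVf.
by rewrite cE.
Qed.

(** The normalization is by the mass under [g2] whereas the integration is against [g1]; the
    hypothesis [ab] makes the two cancel. *)
Let k2 v : c (b v) != 0%R -> \int[g1]_u (k (u, v))%:E = 1.
Proof.
move=> ca; rewrite (eq_integral
    (fun u => ((c (b v))^-1)%:E * (\1_(a @^-1` [set b v]) u)%:E)); last first.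
  by move=> u _; rewrite -EFinM /k mulrC/= /S !indicE.
rewrite ge0_integralZl//=; last 2 first.
- by apply/measurable_EFinP; exact: measurable_indic.
- by rewrite lee_fin invr_ge0 fine_ge0.
rewrite integral_indic// setIT [X in _ * X](_ : _ = (c (b v))%:E).
  by rewrite -EFinM mulVf.
by rewrite cE -ab.
Qed.

Lemma gluing : exists G : {measure set (U * V) -> \bar R},
  [/\ forall A, measurable A -> G (A `*` setT) = g1 A,
      forall B, measurable B -> G (setT `*` B) = g2 B &
      G.-negligible [set p | a p.1 <> b p.2]].
Proof.
have mu0 d (W : measurableType d) (g : {finite_measure set W -> \bar R}) e
    (me : forall n, measurable (e @^-1` [set n])) :
    (forall n, g (e @^-1` [set n]) = (c n)%:E) ->
  g.-negligible [set w | c (e w) = 0%R].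
  move=> ge; rewrite (_ : [set w | _] =
    \bigcup_n (if c n == 0%R then e @^-1` [set n] else set0)); last first.
    apply/seteqP; split=> [w/= cw|w/= [n _]].
      by exists (e w) => //; rewrite cw eqxx.
    by case: ifPn => // /eqP cn /= ->.
  apply: negligible_bigcup => n; case: ifPn => [/eqP cn|_].
    by apply/negligibleP => //; apply: (eq_trans (ge n)); rewrite cn.
  exact: negligible_set0.
(* The partial integrals of [k] are correct only off the classes of mass zero; these form a
   countable union of null sets, so the marginals are not affected. *)
have marg d (W : measurableType d) (g : {finite_measure set W -> \bar R})
    (e : W -> nat) A (h : W -> \bar R)
    (me : forall n, measurable (e @^-1` [set n])) : measurable A ->
    (forall n, g (e @^-1` [set n]) = (c n)%:E) ->
    measurable_fun setT h -> (forall w, 0 <= h w) ->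
    (forall w, c (e w) != 0%R -> h w = (\1_A w)%:E) ->
    \int[g]_w h w = g A.
  move=> mA ge mh h0 h1; rewrite -[A in RHS]setIT -integral_indic//.
  apply: ge0_ae_eq_integral => //.
  - by apply/measurable_EFinP; exact: measurable_indic.
  - apply: (negligibleS _ (mu0 _ _ _ _ me ge)) => w /= hw.
    apply: contrapT => /eqP cw; apply: hw => _; exact: h1.
pose G : {measure set (U * V) -> \bar R} := mdensity (g1 \x g2) mk k0.
exists G; split.
- move=> A mA.
  rewrite /G /= /mdensity integral_mkcond epatch_indic.
  have mf : measurable_fun setT
     (fun p : U * V => (k p)%:E * (\1_(A `*` setT) p)%:E).
    apply: emeasurable_funM => //; apply/measurable_EFinP/measurable_indic.
    exact: measurableX.
  have f0 p : 0 <= (k p)%:E * (\1_(A `*` setT) p)%:E.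
    by rewrite mule_ge0// lee_fin.
  rewrite fubini_tonelli1//; apply: (marg _ _ _ a) => //.
  + by move=> n; rewrite ab cE.
  + exact: measurable_fun_fubini_tonelli_F.
  + by move=> w; exact: integral_ge0.
  + move=> w cw; rewrite /fubini_F.
    rewrite (eq_integral (fun v => (k (w, v))%:E * (\1_A w)%:E)); last first.
      by move=> v _ /=; rewrite !indicE in_setX in_setT andbT.
    rewrite ge0_integralZr//; last 2 first.
      by apply: measurableT_comp mkE _; exact: measurable_pair1.
      by move=> x _; rewrite lee_fin.
    by rewrite k1// mul1e.
- move=> A mA.
  rewrite /G /= /mdensity integral_mkcond epatch_indic.
  have mf : measurable_fun setT
     (fun p : U * V => (k p)%:E * (\1_(setT `*` A) p)%:E).
    apply: emeasurable_funM => //; apply/measurable_EFinP/measurable_indic.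
    exact: measurableX.
  have f0 p : 0 <= (k p)%:E * (\1_(setT `*` A) p)%:E.
    by rewrite mule_ge0// lee_fin.
  rewrite fubini_tonelli2//; apply: (marg _ _ _ b) => //.
  + exact: measurable_fun_fubini_tonelli_G.
  + by move=> w; exact: integral_ge0.
  + move=> w cw; rewrite /fubini_G.
    rewrite (eq_integral (fun u => (k (u, w))%:E * (\1_A w)%:E)); last first.
      by move=> u _ /=; rewrite !indicE in_setX in_setT.
    rewrite ge0_integralZr//; last 2 first.
      by apply: measurableT_comp mkE _; exact: measurable_pair2.
      by move=> x _; rewrite lee_fin.
    by rewrite k2// mul1e.
- apply/negligibleP; first exact: measurableC mS.
  rewrite /G/= /mdensity; apply: integral0_eq => p /= abp.
  by rewrite /k indicE memNset ?mul0r.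
Qed.

End gluing.

(** * Borel measurability on a separable metric space *)

Section borel_measurability.
Context {R : realType} {X : completeMetricType R}.
Local Open Scope ring_scope.

Lemma ball_mdist (x y : X) r : ball x r y <-> mdist x y < r.
Proof. by rewrite ballEmdist. Qed.

Lemma open_mdistP (U : set X) :
  open U <-> forall x, U x -> exists2 e, 0 < e & forall y, mdist x y < e -> U y.
Proof.
split=> [oU x Ux|h].
  have /nbhs_ballP[e /= e0 xeU] : nbhs x U by exact: open_nbhs_nbhs.
  by exists e => // y xy; apply: xeU; apply/ball_mdist.
rewrite openE => x /h[e e0 eU]; apply/nbhs_ballP; exists e => //= y.
by move/ball_mdist; exact: eU.
Qed.

Lemma mdist_le_dist (x y z : X) : `|mdist x z - mdist y z| <= mdist x y.
Proof.
have := metric_triangle x y z; have := metric_triangle y x z.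
by rewrite (metric_sym y x) ler_norml => *; apply/andP; split; lra.
Qed.

Lemma continuous_mdist (f : X -> R) : continuous f <->
  forall x e, 0 < e ->
    exists2 d, 0 < d & forall y, mdist x y < d -> `|f y - f x| < e.
Proof.
split=> [cf x e e0|h x].
  have /cvgrPdist_lt/(_ e e0)/nbhs_ballP[d /= d0 xd] := cf x.
  by exists d => // y xy; rewrite distrC; apply: xd; apply/ball_mdist.
apply/cvgrPdist_lt => e e0; have [d d0 xd] := h x e e0.
apply/nbhs_ballP; exists d => //= y /ball_mdist xy.
by rewrite distrC; exact: xd.
Qed.

Lemma mdist_continuous (x : X) : continuous (mdist x : X -> R).
Proof.
apply/continuous_mdist => y e e0; exists e => // z yz.
rewrite (metric_sym x z) (metric_sym x y).
by rewrite (le_lt_trans (mdist_le_dist _ _ _))// metric_sym.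
Qed.

Lemma open_borel (U : set X) : open U -> measurable (U : set (borel X)).
Proof. exact: sub_sigma_algebra. Qed.

Lemma closed_borel (U : set X) : closed U -> measurable (U : set (borel X)).
Proof.
by rewrite -openC => /open_borel/measurableC; rewrite setCK.
Qed.

Lemma ball_open_mdist (x : X) r : open (ball x r).
Proof.
apply/open_mdistP => y /ball_mdist xy; exists (r - mdist x y).
  by rewrite subr_gt0.
move=> z yz; apply/ball_mdist.
by rewrite (le_lt_trans (metric_triangle x y z))// -ltrBrDl.
Qed.

Lemma ball_borel (x : X) r : measurable (ball x r : set (borel X)).
Proof. by apply: open_borel; exact: ball_open_mdist. Qed.

Lemma lsc_borel (f : X -> R) : (forall a, open [set x | a < f x]) ->
  measurable_fun [set: borel X] f.
Proof.
move=> lf; apply: (measurability _ (RGenOInfty.measurableE R)).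
move=> /= _ [_ [a ->]] <-; apply: measurableI => //.
rewrite (_ : _ @^-1` _ = [set x | a < f x]); first exact: open_borel.
by apply/seteqP; split=> x /=; rewrite in_itv/= andbT.
Qed.

Lemma lsce_borel (f : X -> \bar R) : (forall a, open [set x | a%:E < f x]%E) ->
  measurable_fun [set: borel X] f.
Proof.
move=> lf; apply: (measurability _ (ErealGenOInfty.measurableE R)).
move=> /= _ [_ [a ->]] <-; apply: measurableI => //; rewrite preimage_itvoy.
exact: open_borel.
Qed.

Lemma continuous_borel (f : X -> R) : continuous f ->
  measurable_fun [set: borel X] f.
Proof.
move/continuous_mdist => cf; apply: lsc_borel => a; apply/open_mdistP => x /= afx.
have [|d d0 xd] := cf x (f x - a); first by rewrite subr_gt0.
by exists d => // y /xd; rewrite ltr_norml => /andP[]; lra.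
Qed.

Hypothesis sepX : separable X.

Lemma separable_seq :
  exists s : nat -> X, forall x e, 0 < e -> exists n, mdist x (s n) < e.
Proof.
have [D cD dD] := sepX.
have /pcard_surjP[s sD] := cD; exists s => x e e0.
have [|y [xey /sD[n _ yE]]] := dD (ball x e) _ (ball_open_mdist x e).
  by exists x; apply/ball_mdist; rewrite mdistxx.
by exists n; rewrite yE; apply/ball_mdist.
Qed.

(** The product carries the sigma-algebra of rectangles, so openness in the product is not enough.
    The distance of x and y is the infimum of d(s n, x) + d(s n, y) over a dense sequence, and each
    of these sums is measurable. *)
Lemma mdist_measurable :
  measurable_fun [set: borel X * borel X]
    (fun p => mdist (p.1 : X) (p.2 : X)).
Proof.
have [s sX] := separable_seq.
apply: (measurability _ (RGenInftyO.measurableE R)).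
move=> /= _ [_ [a ->]] <-; apply: measurableI => //.
rewrite (_ : _ @^-1` _ = \bigcup_n
    [set p : borel X * borel X | mdist (s n) p.1 + mdist (s n) p.2 < a]).
  apply: bigcupT_measurable => n.
  have mn (f : borel X * borel X -> borel X) : measurable_fun setT f ->
      measurable_fun setT (fun p => mdist (s n) (f p)).
    move=> mf; apply: (measurableT_comp _ mf).
    by apply: continuous_borel; exact: mdist_continuous.
  rewrite -[X in measurable X]setTI.
  have := measurable_funD (mn _ measurable_fst) (mn _ measurable_snd).
  move=> /(_ measurableT _ (measurable_itv `]-oo, a[)).
  by congr (measurable (_ `&` _)); apply/seteqP; split=> p /=; rewrite in_itv.
apply/seteqP; split=> -[x y]/=; rewrite in_itv/=.
  move=> xya; have [|n xn] := sX x ((a - mdist x y) / 2).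
    by rewrite divr_gt0// subr_gt0.
  exists n => //=; have := metric_triangle (s n) x y.
  by rewrite (metric_sym (s n) x); lra.
move=> [n _ /=]; have := metric_triangle x (s n) y.
by rewrite (metric_sym x (s n)); lra.
Qed.

(** A point is labelled by the first member of a dense sequence at distance less than [e / 2]. *)
Lemma small_partition (e : R) : 0 < e -> exists i : borel X -> nat,
  (forall n, measurable (i @^-1` [set n])) /\
  forall x y : X, i x = i y -> mdist x y < e.
Proof.
move=> e0; have [s sX] := separable_seq.
have h x : exists n, mdist x (s n) < e / 2 by apply: sX; rewrite divr_gt0.
pose i (x : borel X) := ex_minn (h x); exists i; split=> [n|x y].
  rewrite (_ : _ @^-1` _ = (ball (s n) (e / 2) : set (borel X)) `&`
      \bigcap_(m in [set m | (m < n)%N]) ~` (ball (s m) (e / 2))).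
    apply: measurableI; first exact: ball_borel.
    by apply: bigcap_measurableType => m _; apply: measurableC; exact: ball_borel.
  apply/seteqP; split=> [x /= <-|x /= [/ball_mdist xn xm]].
    rewrite /i; case: ex_minnP => m xm mmin; split.
      by apply/ball_mdist; rewrite metric_sym.
    move=> k /= km /ball_mdist; rewrite metric_sym => /mmin.
    by rewrite leqNgt km.
  rewrite /i; case: ex_minnP => m xm' mmin; apply/eqP; rewrite eqn_leq.
  rewrite mmin 1?metric_sym//= leqNgt; apply/negP => mn.
  by apply: (xm m mn); apply/ball_mdist; rewrite metric_sym.
rewrite /i; case: ex_minnP => m xm _; case: ex_minnP => k yk _ mk.
by have := metric_triangle x (s m) y; rewrite -mk (metric_sym y) in yk *; lra.
Qed.

End borel_measurability.

(** * Displacement along Wasserstein geodesics *)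

Section image_measure.
Context d1 d2 (T1 : measurableType d1) (T2 : measurableType d2) (R : realType).
Variables (mu : {measure set T1 -> \bar R}) (phi : T1 -> T2).
Hypothesis mphi : measurable_fun setT phi.

Lemma image_measure : exists nu : {measure set T2 -> \bar R},
  forall A, nu A = mu (phi @^-1` A).
Proof.
by unshelve eexists (pushforward mu phi); first exact: mphi.
Qed.

Lemma integral_image_measure (nu : {measure set T2 -> \bar R}) f :
  (forall A, measurable A -> nu A = mu (phi @^-1` A)) ->
  measurable_fun setT f -> (forall y, 0 <= f y) ->
  \int[nu]_y f y = \int[mu]_x f (phi x).
Proof.
move=> nuE mf f0; rewrite (eq_measure_integral (pushforward mu phi)).
  by rewrite ge0_integral_pushforward.
by move=> A mA _; exact: nuE.
Qed.

End image_measure.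

Lemma finite_measure_lty d (T : measurableType d) (R : realType)
    (mu : {measure set T -> \bar R}) : mu setT < +oo ->
  exists nu : {finite_measure set T -> \bar R}, forall A, nu A = mu A.
Proof.
move=> muoo; exists (mfrestr measurableT muoo).
by move=> A; rewrite -[A in RHS]setIT.
Qed.

(** Quantitative form of (a + b)^2 <= a^2/t + b^2/(1 - t): the defect controls how far a and b are
    from dividing the distance in the ratio t : 1 - t. Here [a] and [b] are the lengths of the two
    legs, [e] is the mismatch at the middle point, and [s] is the excess to be excluded. *)
Lemma displacement_cost (R : realFieldType) (a b d t s L e : R) :
  (0 < t < 1 -> 0 <= a -> 0 <= b -> 0 <= d <= L -> d <= a + b + e ->
   0 <= e -> 0 <= s ->
   d ^+ 2 + (if (t * L + s <= a) || ((1 - t) * L + s <= b) then s ^+ 2 else 0)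
   <= t^-1 * a ^+ 2 + (1 - t)^-1 * b ^+ 2 + 2 * L * e)%R.
Proof.
move=> /andP[t0 t1] a0 b0 /andP[d0 dL] dab e0 s0; set w := (if _ then _ else _).
(* Subtracting the mismatch gives a length [f] that is at most [a + b] exactly; in the squares this
   costs only [2 * L * e]. *)
pose f : R := Num.max 0%R (d - e)%R.
have f0 : (0 <= f)%R by rewrite /f le_max lexx.
have fL : (f <= L)%R by rewrite /f ge_max; apply/andP; split; lra.
have fab : (f <= a + b)%R by rewrite /f ge_max; apply/andP; split; lra.
have df : (d ^+ 2 <= f ^+ 2 + 2 * L * e)%R.
  have deL : (d * e <= L * e)%R by rewrite ler_wpM2r.
  rewrite /f; case: (leP 0%R (d - e)%R) => de; first by have := sqr_ge0 e; lra.
  have : (d * d <= d * e)%R by rewrite ler_wpM2l//; lra.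
  have : (0 <= d * e)%R by rewrite mulr_ge0.
  lra.
(* Completing the square: the difference of the two extreme terms is r^-1 (x - r u)^2, and r^-1 >=
   1. It is applied with [u := f] to both legs, whose weights [t] and [1 - t] add up to 1. *)
have sq (x u r : R) : (0 < r -> r < 1 -> 2 * x * u - r * u ^+ 2 + (x - r * u) ^+ 2
    <= r^-1 * x ^+ 2)%R.
  move=> r0 r1.
  rewrite -(@ler_pM2l _ r)// [leRHS]mulrA divff ?gt_eqF// mul1r.
  have : (r * (x - r * u) ^+ 2 <= (x - r * u) ^+ 2)%R.
    by rewrite ler_piMl ?sqr_ge0// ltW.
  nra.
have sa := sq a f t t0 t1; have sb := sq b f (1 - t)%R _ _.
have {}sb := sb ltac:(lra) ltac:(lra).
have fab2 : (f * f <= f * (a + b))%R by rewrite ler_wpM2l.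
have tf : (t * f <= t * L)%R by rewrite ler_wpM2l// ltW.
have tf' : ((1 - t) * f <= (1 - t) * L)%R by rewrite ler_wpM2l//; lra.
have ws : (w <= (a - t * f) ^+ 2 + (b - (1 - t) * f) ^+ 2)%R.
  rewrite /w; case: ifPn => [/orP[h|h]|_].
  - have : (s * s <= (a - t * f) * (a - t * f))%R by apply: ler_pM => //; lra.
    by have := sqr_ge0 (b - (1 - t) * f)%R; nra.
  - have : (s * s <= (b - (1 - t) * f) * (b - (1 - t) * f))%R.
      by apply: ler_pM => //; lra.
    by have := sqr_ge0 (a - t * f)%R; nra.
  - by rewrite addr_ge0// sqr_ge0.
nra.
Qed.

Section displacement.
Context {R : realType} {X : completeMetricType R}.
Hypothesis sepX : separable X.
Implicit Types mu nu : probability (borel X) R.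

Let dist (p : borel X * borel X) : R := mdist (p.1 : X) (p.2 : X).

Let mdist2 : measurable_fun setT (fun p => (dist p ^+ 2)%:E).
Proof.
by apply/measurable_EFinP/measurable_funX; exact: mdist_measurable.
Qed.

(** The square of [W2]: the displacement estimate is quadratic and never takes the root. *)
Definition W2_cost mu nu : \bar R :=
  ereal_inf [set c | exists2 g : {measure set (borel X * borel X)%type -> \bar R},
    coupling mu nu g & c = \int[g]_p (mdist (p.1 : X) (p.2 : X) ^+ 2)%:E].

Lemma W2_cost_ge0 mu nu : 0 <= W2_cost mu nu.
Proof.
apply: le_ereal_inf_tmp => _ [g _ ->]; apply: integral_ge0 => p _.
by rewrite lee_fin sqr_ge0.
Qed.

(** Nearly optimal couplings stand in for optimal ones. Finiteness, which the gluing requires, comes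
    from the marginal being a probability. *)
Lemma W2_cost_lt_coupling mu nu c : W2_cost mu nu < c ->
  exists2 g : {finite_measure set (borel X * borel X)%type -> \bar R},
    coupling mu nu g & \int[g]_p (dist p ^+ 2)%:E < c.
Proof.
move=> /ereal_inf_lt[_ [g gmu ->]] gc.
have [|g' g'E] := @finite_measure_lty _ _ _ g.
  by rewrite -setXTT (gmu _ measurableT).1 probability_setT ltry.
exists g'; last first.
  by rewrite (eq_measure_integral g) // => A _ _; exact: g'E.
move=> A mA; have [gA1 gA2] := gmu _ mA.
by split; [rewrite -gA1|rewrite -gA2]; exact: g'E.
Qed.

Let product_probE mu nu (A B : set (borel X)) : measurable A -> measurable B ->
  (mu \x nu) (A `*` B) = mu A * nu B.
Proof. exact: product_measure1E. Qed.

(** The product coupling is a competitor. The bound makes the cost finite, so that it can be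
    cancelled in the displacement estimate. *)
Lemma W2_cost_bounded mu nu F0 F1 L : measurable F0 -> measurable F1 ->
  mu (~` F0) = 0 -> nu (~` F1) = 0 ->
  (forall x y : X, F0 x -> F1 y -> (mdist x y <= L)%R) ->
  W2_cost mu nu <= (L ^+ 2)%:E.
Proof.
move=> mF0 mF1 muF0 nuF1 F01.
apply: ge_ereal_inf; exists (\int[mu \x nu]_p (dist p ^+ 2)%:E).
  exists (mu \x nu) => //.
  move=> A mA; split; rewrite [LHS]product_probE//.
    by rewrite probability_setT mule1.
  by rewrite probability_setT mul1e.
rewrite (@le_trans _ _ (\int[mu \x nu]_p (L ^+ 2)%:E))//; last first.
  rewrite integral_cst//= -setXTT [X in _ * X]product_probE//.
  by rewrite !probability_setT !mule1.
apply: ae_ge0_le_integral => //.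
- by move=> p _; rewrite lee_fin sqr_ge0.
- by move=> p _; rewrite lee_fin sqr_ge0.
exists (((~` F0) `*` setT) `|` (setT `*` (~` F1))); split.
- by apply: measurableU; apply: measurableX => //; exact: measurableC.
- apply/eqP; rewrite -measure_le0 (le_trans (measureU2 _ _ _))//.
  + by apply: measurableX => //; exact: measurableC.
  + by apply: measurableX => //; exact: measurableC.
  by rewrite /= !product_probE//; try exact: measurableC;
    rewrite muF0 nuF1 mul0e mule0 adde0.
- move=> [x y] /=; apply: contra_notP => /not_orP[].
  rewrite /= => /not_andP[/contrapT F0x|//] /not_andP[//|/contrapT F1y] _.
  have xyL : (dist (x, y) <= L)%R by exact: F01.
  have xy0 : (0 <= dist (x, y))%R by exact: mdist_ge0.
  by rewrite lee_fin ler_sqr// nnegrE//; exact: le_trans xyL.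
Qed.

Lemma W2_geodesic_cost (mu_ : R -> probability (borel X) R) s t :
  W2_geodesic mu_ -> (0 <= s <= 1)%R -> (0 <= t <= 1)%R ->
  W2_cost (mu_ s) (mu_ t) = ((t - s) ^+ 2)%:E * W2_cost (mu_ 0%R) (mu_ 1%R).
Proof.
move=> geo s01 t01; have := geo _ _ s01 t01; rewrite /W2 -!/(W2_cost _ _) => st.
have sqrt2 (x : \bar R) : 0 <= x -> (x `^ 2^-1) `^ 2 = x.
  by move=> x0; rewrite -poweRrM mulVf ?pnatr_eq0// poweRe1.
rewrite -(sqrt2 (W2_cost _ _)) ?W2_cost_ge0// st poweRM ?poweR_ge0//.
rewrite sqrt2 ?W2_cost_ge0//; congr (_ * _).
by rewrite poweR_EFin powR_mulrn// real_normK// num_real.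
Qed.

Section gluing_couplings.
Variables (mu nu rho : probability (borel X) R).
Variables g1 g2 : {finite_measure set (borel X * borel X)%type -> \bar R}.
Hypotheses (g1mu : coupling mu nu g1) (g2nu : coupling nu rho g2).

(* The exact gluing would need a disintegration; matching the middle points only
   up to a partition into sets of diameter at most [e] does not. *)
Lemma gluing_couplings (e : R) : (0 < e)%R ->
  exists G : {measure set ((borel X * borel X) * (borel X * borel X))%type -> \bar R},
  [/\ forall A, measurable A -> G (fst @^-1` A) = g1 A,
      forall A, measurable A -> G (snd @^-1` A) = g2 A,
      G.-negligible [set p | (e <= mdist (p.1.2 : X) (p.2.1 : X))%R] &
      W2_cost mu rho <= \int[G]_p (dist (p.1.1, p.2.2) ^+ 2)%:E].
Proof.
move=> e0; have [i [mi iE]] := small_partition sepX e0.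
have [n|n|n|G [G1 G2 G3]] := @gluing _ _ _ _ _ g1 g2 (i \o snd) (i \o fst).
- by rewrite comp_preimage -[X in measurable X]setTI; exact: measurable_snd.
- by rewrite comp_preimage -[X in measurable X]setTI; exact: measurable_fst.
- have [_ g1n] := g1mu (mi n); have [g2n _] := g2nu (mi n).
  by rewrite setTX in g1n; rewrite setXT in g2n; rewrite g1n -g2n.
have G1' A : measurable A -> G (fst @^-1` A) = g1 A.
  by move=> mA; rewrite -setXT; exact: G1.
have G2' A : measurable A -> G (snd @^-1` A) = g2 A.
  by move=> mA; rewrite -setTX; exact: G2.
exists G; split => //.
  apply: negligibleS G3 => -[[x z] [z' y]]/= zz' izz'.
  by move: zz'; rewrite leNgt iE.
have mxy : measurable_fun setT
    (fun p : (borel X * borel X) * (borel X * borel X) => (p.1.1, p.2.2)).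
  by apply: measurable_fun_pair; exact: measurableT_comp.
have [g gE] := @image_measure _ _ _ _ _ G _ mxy.
apply: ge_ereal_inf; exists (\int[g]_p (dist p ^+ 2)%:E).
  exists g => // A mA; split; rewrite gE.
    transitivity (G (fst @^-1` (A `*` setT))) => //.
    exact: eq_trans (G1' _ (measurableX mA measurableT)) (g1mu mA).1.
  transitivity (G (snd @^-1` (setT `*` A))) => //.
  exact: eq_trans (G2' _ (measurableX measurableT mA)) (g2nu mA).2.
by rewrite (@integral_image_measure _ _ _ _ _ G _ mxy g)// => *; rewrite lee_fin sqr_ge0.
Qed.

End gluing_couplings.

(** With c the squared distance of the end measures, the two legs cost about t^2 c and (1 - t)^2 c,
    while the glued plan costs at least c. In the integrated form of [displacement_cost] the weights
    t^-1 and (1 - t)^-1 turn the leg costs into t c + (1 - t) c = c, so c cancels. What is left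
    bounds [s ^+ 2] times the mass of the bad set by the errors. *)
Lemma displacement (mu_ : R -> probability (borel X) R) F0 F1 L t s delta :
  W2_geodesic mu_ -> measurable F0 -> measurable F1 ->
  mu_ 0%R (~` F0) = 0 -> mu_ 1%R (~` F1) = 0 ->
  (forall x y : X, F0 x -> F1 y -> (mdist x y <= L)%R) ->
  (0 < t < 1)%R -> (0 < s)%R -> (0 < delta)%R ->
  exists g1 g2 : {finite_measure set (borel X * borel X)%type -> \bar R},
  [/\ coupling (mu_ 0%R) (mu_ t) g1, coupling (mu_ t) (mu_ 1%R) g2,
      g1 [set p | (t * L + s <= dist p)%R] <= delta%:E &
      g2 [set p | ((1 - t) * L + s <= dist p)%R] <= delta%:E].
Proof.
move=> geo mF0 mF1 muF0 muF1 F01 /andP[t0 t1] s0 delta0.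
have t01 : (0 < t < 1)%R by rewrite t0.
have u0 : (0 < 1 - t)%R by rewrite subr_gt0.
have Z01 : (0 <= (0 : R) <= 1)%R by rewrite lexx ler01.
have O01 : (0 <= (1 : R) <= 1)%R by rewrite lexx ler01.
have T01 : (0 <= t <= 1)%R by rewrite !ltW.
have L0 : (0 <= L)%R.
  have [x0 F0x] : F0 !=set0.
    apply/set0P/eqP => F00; move: muF0; rewrite F00 setC0 probability_setT.
    by move=> [] /eqP; rewrite oner_eq0.
  have [x1 F1x] : F1 !=set0.
    apply/set0P/eqP => F10; move: muF1; rewrite F10 setC0 probability_setT.
    by move=> [] /eqP; rewrite oner_eq0.
  exact: le_trans (mdist_ge0 (x0 : X) x1) (F01 _ _ F0x F1x).
set w := W2_cost (mu_ 0%R) (mu_ 1%R).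
have [c wE] : exists c, w = c%:E.
  exists (fine w); rewrite fineK// ge0_fin_numE ?W2_cost_ge0//.
  by rewrite (le_lt_trans (W2_cost_bounded mF0 mF1 muF0 muF1 F01))// ltry.
(* [C] collects the coefficients of [e] in the final estimate: the first two come from the near
   optimality of the legs, the last from the mismatch in the gluing. The choice of [e] makes the
   total error [s ^+ 2 * delta]. *)
pose C := (t^-1 + (1 - t)^-1 + 2 * L)%R.
have C0 : (0 < C)%R.
  by rewrite /C ltr_wpDr ?mulr_ge0// addr_gt0 ?invr_gt0.
pose e := (s ^+ 2 * delta / C)%R.
have e0 : (0 < e)%R by rewrite /e divr_gt0// mulr_gt0// exprn_gt0.
have eC : (s ^+ 2 * delta = e * C)%R by rewrite /e divfK// gt_eqF.
clearbody e.
have [|g1 g1c g1e] := @W2_cost_lt_coupling (mu_ 0%R) (mu_ t) (t ^+ 2 * c + e)%:E.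
  by rewrite (W2_geodesic_cost geo)// subr0 -/w wE -EFinM lte_fin ltrDl.
have [|g2 g2c g2e] := @W2_cost_lt_coupling (mu_ t) (mu_ 1%R)
    ((1 - t) ^+ 2 * c + e)%:E.
  by rewrite (W2_geodesic_cost geo)// -/w wE -EFinM lte_fin ltrDl.
exists g1, g2.
have [G [G1 G2 Ge GW]] := gluing_couplings g1c g2c e0.
rewrite -/w wE in GW.
pose B1 : set (borel X * borel X) := [set p | (t * L + s <= dist p)%R].
pose B2 : set (borel X * borel X) := [set p | ((1 - t) * L + s <= dist p)%R].
have mB r : measurable [set p : borel X * borel X | (r <= dist p)%R].
  have := mdist_measurable sepX measurableT (measurable_itv `[r, +oo[).
  rewrite setTI; congr measurable.
  by apply/seteqP; split=> p /=; rewrite in_itv/= andbT.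
pose B : set ((borel X * borel X) * (borel X * borel X)) :=
  fst @^-1` B1 `|` snd @^-1` B2.
have mB1 : measurable (fst @^-1` B1 :
    set ((borel X * borel X) * (borel X * borel X))).
  by rewrite -[X in measurable X]setTI; apply: measurable_fst => //; exact: mB.
have mB2 : measurable (snd @^-1` B2 :
    set ((borel X * borel X) * (borel X * borel X))).
  by rewrite -[X in measurable X]setTI; apply: measurable_snd => //; exact: mB.
have mBB : measurable B by exact: measurableU.
suff GB : G B <= delta%:E.
  split => //.
    rewrite -G1; last exact: mB.
    by rewrite (le_trans _ GB)// le_measure ?inE//; exact: subsetUl.
  rewrite -G2; last exact: mB.
  by rewrite (le_trans _ GB)// le_measure ?inE//; exact: subsetUr.
pose Tc := ((borel X * borel X) * (borel X * borel X))%type.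
have Gg (f : borel X * borel X -> \bar R) (mf : measurable_fun setT f)
    (f0 : forall p, 0 <= f p) :
    \int[G]_p f p.1 = \int[g1]_p f p /\ \int[G]_p f p.2 = \int[g2]_p f p.
  split; apply/esym.
  - by apply: (integral_image_measure measurable_fst) => // A mA; exact/esym/G1.
  - by apply: (integral_image_measure measurable_snd) => // A mA; exact/esym/G2.
have GT : G setT = 1.
  rewrite -(probability_setT (mu_ 0%R)) -(g1c _ measurableT).1 setXTT.
  exact: (G1 _ measurableT).
have d2 : measurable_fun setT (fun p => (dist p ^+ 2)%:E) by exact: mdist2.
have d20 p : 0 <= (dist p ^+ 2)%:E by rewrite lee_fin sqr_ge0.
have mA1 : measurable_fun setT (fun p : Tc => (dist p.1 ^+ 2)%:E).
  exact: (measurableT_comp d2 measurable_fst).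
have mA2 : measurable_fun setT (fun p : Tc => (dist p.2 ^+ 2)%:E).
  exact: (measurableT_comp d2 measurable_snd).
have mA3 : measurable_fun setT (fun p : Tc => (dist (p.1.1, p.2.2) ^+ 2)%:E).
  apply: (measurableT_comp d2).
  by apply: measurable_fun_pair; exact: measurableT_comp.
have mIB : measurable_fun setT (fun p : Tc => (\1_B p)%:E : \bar R).
  exact/measurable_EFinP/measurable_indic.
(* The pointwise inequality is integrated off three null sets: the middle points at distance [e] or
   more, the starting points outside [F0], and the end points outside [F1]. *)
have : \int[G]_p ((dist (p.1.1, p.2.2) ^+ 2)%:E + (s ^+ 2)%:E * (\1_B p)%:E) <=
       \int[G]_p ((t^-1)%:E * (dist p.1 ^+ 2)%:E +
         ((1 - t)^-1)%:E * (dist p.2 ^+ 2)%:E + (2 * L * e)%:E).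
  have ti0 : (0 <= t^-1)%R by rewrite invr_ge0 ltW.
  have ui0 : (0 <= (1 - t)^-1)%R by rewrite invr_ge0 ltW.
  have Le0 : (0 <= 2 * L * e)%R by apply: mulr_ge0; [exact: mulr_ge0|exact: ltW].
  apply: ae_ge0_le_integral => //.
  - by move=> p _; rewrite adde_ge0// mule_ge0// lee_fin// sqr_ge0.
  - apply: emeasurable_funD => //; exact: measurable_funeM.
  - by move=> p _; rewrite !adde_ge0// mule_ge0.
  - apply: emeasurable_funD => //.
    by apply: emeasurable_funD => //; exact: measurable_funeM.
  have N1 : G.-negligible [set p | ~ F0 p.1.1].
    exists (fst @^-1` (~` F0 `*` setT)); split => //.
    + rewrite -[X in measurable X]setTI; apply: measurable_fst => //.
      by apply: measurableX => //; exact: measurableC.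
    + rewrite G1; last by apply: measurableX => //; exact: measurableC.
      exact: eq_trans (g1c _ (measurableC mF0)).1 _.
  have N2 : G.-negligible [set p | ~ F1 p.2.2].
    exists (snd @^-1` (setT `*` ~` F1)); split => //.
    + rewrite -[X in measurable X]setTI; apply: measurable_snd => //.
      by apply: measurableX => //; exact: measurableC.
    + rewrite G2; last by apply: measurableX => //; exact: measurableC.
      exact: eq_trans (g2c _ (measurableC mF1)).2 _.
  apply: negligibleS (negligibleU Ge (negligibleU N1 N2)) => -[[x z] [z' y]].
  apply: contra_notP => /= /not_orP[/negP zz' /not_orP[/contrapT F0x /contrapT F1y]] _.
  rewrite -ltNge in zz'.
  have xyL : (0 <= mdist (x : X) y <= L)%R by rewrite mdist_ge0 F01.
  have tri : (mdist (x : X) y <= mdist (x : X) z + mdist (z' : X) y + e)%R.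
    have := metric_triangle (x : X) z y; have := metric_triangle (z : X) z' y.
    lra.
  have := displacement_cost t01 (mdist_ge0 (x : X) z) (mdist_ge0 (z' : X) y)
    xyL tri (ltW e0) (ltW s0).
  rewrite -!EFinM -!EFinD lee_fin; congr (_ + _ <= _)%R.
  rewrite indicE; case: ifPn => [zB|zB].
    by rewrite mem_set ?mulr1//= /B/B1/B2/=; apply/orP.
  by rewrite memNset ?mulr0//= /B/B1/B2/=; apply/orP.
have ti0 : (0 <= t^-1)%R by rewrite invr_ge0 ltW.
have ui0 : (0 <= (1 - t)^-1)%R by rewrite invr_ge0 ltW.
have Le0 : (0 <= 2 * L * e)%R by apply: mulr_ge0; [exact: mulr_ge0|exact: ltW].
rewrite ge0_integralD//; last 2 first.
  by move=> p _; rewrite mule_ge0// lee_fin sqr_ge0.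
  exact: measurable_funeM.
rewrite ge0_integralZl//; last by rewrite lee_fin sqr_ge0.
rewrite integral_indic// setIT.
rewrite ge0_integralD//; last 2 first.
  by move=> p _; rewrite adde_ge0// mule_ge0// lee_fin.
  by apply: emeasurable_funD => //; exact: measurable_funeM.
rewrite ge0_integralD//; last 4 first.
  by move=> p _; rewrite mule_ge0// lee_fin.
  exact: measurable_funeM.
  by move=> p _; rewrite mule_ge0// lee_fin.
  exact: measurable_funeM.
rewrite ge0_integralZl//.
rewrite ge0_integralZl//.
rewrite integral_cst// GT mule1.
rewrite (Gg _ d2 d20).1 (Gg _ d2 d20).2.
have i0 (g : {finite_measure set (borel X * borel X)%type -> \bar R}) :
  0 <= \int[g]_p (dist p ^+ 2)%:E by apply: integral_ge0.
have [i1 i1E] : exists i1, \int[g1]_p (dist p ^+ 2)%:E = i1%:E.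
  by eexists; rewrite -[LHS]fineK// ge0_fin_numE// (lt_trans g1e)// ltry.
have [i2 i2E] : exists i2, \int[g2]_p (dist p ^+ 2)%:E = i2%:E.
  by eexists; rewrite -[LHS]fineK// ge0_fin_numE// (lt_trans g2e)// ltry.
have [b bE] : exists b, G B = b%:E.
  eexists; rewrite -[LHS]fineK// ge0_fin_numE// (@le_lt_trans _ _ (G setT))//.
    by rewrite le_measure ?inE.
  by rewrite GT ltry.
rewrite i1E lte_fin in g1e; rewrite i2E lte_fin in g2e.
rewrite i1E i2E bE => H.
have {H} : (c + s ^+ 2 * b <= t^-1 * i1 + (1 - t)^-1 * i2 + 2 * L * e)%R.
  rewrite -lee_fin !EFinD !EFinM; apply: le_trans H.
  by rewrite leeD2r.
have : (t^-1 * i1 <= t * c + e * t^-1)%R.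
  rewrite -(@ler_pM2l _ t)// mulrA divff ?gt_eqF// mul1r.
  suff -> : (t * (t * c + e * t^-1) = t ^+ 2 * c + e)%R by exact: ltW.
  by field; rewrite gt_eqF.
have : ((1 - t)^-1 * i2 <= (1 - t) * c + e * (1 - t)^-1)%R.
  rewrite -(@ler_pM2l _ (1 - t)%R)// mulrA divff ?gt_eqF// mul1r.
  suff -> : ((1 - t) * ((1 - t) * c + e * (1 - t)^-1) =
      (1 - t) ^+ 2 * c + e)%R by exact: ltW.
  by field; rewrite gt_eqF.
move=> h1 h2 h3; rewrite lee_fin.
rewrite -(@ler_pM2l _ (s ^+ 2))%R ?exprn_gt0//.
by rewrite eC /C; lra.
Qed.

End displacement.

(** * Curvature-dimension condition between densities *)

Lemma mnormalize1 d (T : measurableType d) (R : realType)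
    (mu : {measure set T -> \bar R}) (P : probability T R) A :
  mu setT = 1 -> mnormalize mu P A = mu A.
Proof.
move=> mu1; rewrite /mnormalize mu1 onee_eq0 (lt_eqF (ltry 1)).
by rewrite /= invr1 mule1.
Qed.

Section density_curvature.
Context {R : realType} {X : completeMetricType R}.
Variable m : {measure set (borel X) -> \bar R}.

(** Normalizing a measure of mass 1 leaves it unchanged and supplies the structure of a probability;
    the Dirac mass is only the default argument of the normalization. *)
Lemma density_probability (f : borel X -> R) : measurable_fun setT f ->
  (forall x, (0 <= f x)%R) -> \int[m]_x (f x)%:E = 1 ->
  exists mu : probability (borel X) R,
    forall A, measurable A -> mu A = \int[m]_(x in A) (f x)%:E.
Proof.
move=> mf f0 f1; pose d : {measure set (borel X) -> \bar R} := mdensity m mf f0.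
have dT : d setT = 1 by exact: f1.
have dirac_prob : {P : probability (borel X) R | True}.
  by exists (dirac (point : borel X)).
case: dirac_prob => P _.
exists (mnormalize d P) => A mA.
exact: (mnormalize1 P A dT).
Qed.

(** [ac_density] is a choice among the densities of Lebesgue decompositions, so uniqueness has to be
    proved. Off the null set that carries the singular part, both densities integrate to [mu]. *)
Lemma ae_eq_ac_density (mu : probability (borel X) R) (f : borel X -> R) :
  measurable_fun setT f -> (forall x, (0 <= f x)%R) ->
  (forall A, measurable A -> mu A = \int[m]_(x in A) (f x)%:E) ->
  is_ac_density m mu (ac_density m mu) /\
  ae_eq m setT (EFin \o ac_density m mu) (EFin \o f).
Proof.
move=> mf f0 muE.
have fac : is_ac_density m mu f.
  split => //; exists mzero; split; first by exists set0.
  by move=> A mA; rewrite [X in _ + X](_ : _ = 0)// adde0 muE.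
have := xgetPex (cst 0%R) (ex_intro _ f fac); rewrite -/(ac_density m mu).
set rho := ac_density m mu => rhoac; split => //.
have [mrho rho0 [nu [[N [mN N0 nuN]] nuE]]] := rhoac.
apply: ae_eq_sym; apply: integral_ae_eq => //.
- apply/integrableP; split; first exact/measurable_EFinP.
  under eq_integral do rewrite /= ger0_norm//.
  by rewrite -muE// probability_setT ltry.
- exact/measurable_EFinP.
- move=> A _ mA.
  have restr (g : borel X -> R) : measurable_fun setT g ->
      (forall x, (0 <= g x)%R) ->
      \int[m]_(x in A) (g x)%:E = \int[m]_(x in A `\` N) (g x)%:E.
    move=> mg g0; apply: ge0_negligible_integral => //.
    + exact/measurable_EFinP/measurable_funTS.
    + by move=> x _; rewrite lee_fin.
  rewrite /= (restr f)// (restr rho)// -muE; last exact: measurableD.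
  rewrite nuE; last exact: measurableD.
  rewrite [X in _ + X](_ : _ = 0) ?adde0//.
  apply: (subset_measure0 _ _ _ nuN); first exact: measurableD.
  - exact: measurableC.
  - by move=> x [].
Qed.

Lemma renyi_entropy_density (mu : probability (borel X) R) (f : borel X -> R) n :
  measurable_fun setT f -> (forall x, (0 <= f x)%R) ->
  (forall A, measurable A -> mu A = \int[m]_(x in A) (f x)%:E) ->
  renyi_entropy m n mu = - \int[m]_x (f x `^ (1 - n^-1))%:E.
Proof.
move=> mf f0 muE; have [[mrho rho0 _] rhof] := ae_eq_ac_density mf f0 muE.
rewrite /renyi_entropy; congr (- _); apply: ge0_ae_eq_integral => //.
- by apply/measurable_EFinP; exact: measurableT_comp (measurable_powR _) _.
- by apply/measurable_EFinP; exact: measurableT_comp (measurable_powR _) _.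
- by move=> x _; rewrite lee_fin powR_ge0.
- by move=> x _; rewrite lee_fin powR_ge0.
- by apply: filterS rhof => x /= + _ => /(_ Logic.I) [] ->.
Qed.

Lemma mbounded_msupport (mu : probability (borel X) R) (x : X) r :
  mu (~` ball x r) = 0 -> mbounded (msupport mu).
Proof.
(* The extra 1 leaves room for a unit ball around [y] that misses [ball x r]. *)
move=> mu0; exists x, (r + 1)%R => y /= suppy; apply/ball_mdist.
rewrite ltNge; apply/negP => xy.
have := suppy (ball y 1) (ball_open_mdist y 1%R).
rewrite lt_neqAle => /(_ _)/andP[|+ _].
  by apply/ball_mdist; rewrite mdistxx.
move/eqP; apply; apply/esym; apply: (subset_measure0 _ _ _ mu0).
- exact: ball_borel.
- by apply: measurableC; exact: ball_borel.
- move=> z /ball_mdist yz /ball_mdist xz.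
  by have := metric_triangle x z y; rewrite (metric_sym z y); lra.
Qed.

(** The form in which the curvature condition is applied: the end measures are given by densities,
    and their entropies are explicit integrals. *)
Lemma CD0_densities n (f0 f1 : borel X -> R) :
  CD0 m n ->
  measurable_fun setT f0 -> (forall x, (0 <= f0 x)%R) ->
  \int[m]_x (f0 x)%:E = 1 ->
  measurable_fun setT f1 -> (forall x, (0 <= f1 x)%R) ->
  \int[m]_x (f1 x)%:E = 1 ->
  mbounded [set x : X | f0 x != 0%R] -> mbounded [set x : X | f1 x != 0%R] ->
  exists mu_ : R -> probability (borel X) R,
    [/\ W2_geodesic mu_,
        forall A, measurable A -> mu_ 0%R A = \int[m]_(x in A) (f0 x)%:E,
        forall A, measurable A -> mu_ 1%R A = \int[m]_(x in A) (f1 x)%:E &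
        forall t, (0 <= t <= 1)%R -> renyi_entropy m n (mu_ t) <=
          - ((1 - t)%:E * \int[m]_x (f0 x `^ (1 - n^-1))%:E +
             t%:E * \int[m]_x (f1 x `^ (1 - n^-1))%:E)].
Proof.
move=> CDm mf0 f00 If0 mf1 f10 If1 [x0 [r0 b0]] [x1 [r1 b1]].
have [mu0 mu0E] := density_probability mf0 f00 If0.
have [mu1 mu1E] := density_probability mf1 f10 If1.
have dom (f : borel X -> R) (mu : probability (borel X) R) :
    measurable_fun setT f ->
    (forall A, measurable A -> mu A = \int[m]_(x in A) (f x)%:E) -> mu `<< m.
  move=> mf muE; apply/null_content_dominatesP => A mA A0.
  rewrite muE//; apply: null_set_integral => //.
  exact/measurable_EFinP/measurable_funTS.
have bd (f : borel X -> R) (mu : probability (borel X) R) x r :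
    (forall A, measurable A -> mu A = \int[m]_(x in A) (f x)%:E) ->
    [set x : X | f x != 0%R] `<=` ball x r -> mbounded (msupport mu).
  move=> muE fr; apply: (@mbounded_msupport _ x r); rewrite muE.
    apply: integral0_eq => y /= yr; apply/eqP; rewrite eqe.
    by apply/negPn/negP => /fr.
  by apply: measurableC; exact: ball_borel.
have [mu_ [geo jn ent]] := CDm mu0 mu1 (bd _ _ _ _ mu0E b0) (bd _ _ _ _ mu1E b1)
  (dom _ _ mf0 mu0E) (dom _ _ mf1 mu1E).
exists mu_; split => //.
- by move=> A mA; rewrite (jn A mA).1 mu0E.
- by move=> A mA; rewrite (jn A mA).2 mu1E.
- move=> t t01; apply: le_trans (ent t n t01 (lexx _)) _.
  rewrite (renyi_entropy_density _ mf0 f00 mu0E).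
  rewrite (renyi_entropy_density _ mf1 f10 mu1E).
  (* Both integrals are nonnegative, so taking out the sign meets no [+oo - oo]. *)
  rewrite !muleN -oppeD// ge0_adde_def// inE mule_ge0 ?lee_fin//.
  + by move: t01 => /andP[_]; rewrite subr_ge0.
  + by apply: integral_ge0 => x _; rewrite lee_fin powR_ge0.
  + by move: t01 => /andP[].
  + by apply: integral_ge0 => x _; rewrite lee_fin powR_ge0.
Qed.

End density_curvature.

(** * Compactness of closed balls *)

Section hopf_rinow.
Context {R : realType} {X : completeMetricType R}.
Local Open Scope ring_scope.

Definition mclosed_ball (x : X) r := [set y | mdist x y <= r].

Lemma closed_mclosed_ball x r : closed (mclosed_ball x r).
Proof.
rewrite -openC; apply/open_mdistP => y /= /negP; rewrite -ltNge => ry.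
exists (mdist x y - r); first by rewrite subr_gt0.
move=> z yz /=; apply/negP; rewrite -ltNge.
by have := metric_triangle x z y; rewrite (metric_sym z y); lra.
Qed.

(** Points of [A] are moved to nearby points of [K]; the image of the ultrafilter clusters at some
    [p] in [K]. An ultrafilter cannot avoid the preimage of [ball p e] without contradicting
    this. *)
Lemma compact_near_ultra (K A : set X) (F : set_system X) (e : R) :
  compact K -> 0 < e -> UltraFilter F -> F A ->
  (forall y, A y -> exists2 z, K z & mdist z y < e) ->
  exists2 p, K p & F (ball p (2 * e)).
Proof.
move=> cK e0 FF FA AK.
have /choice[z zP] : forall y, exists z, A y -> K z /\ mdist z y < e.
  move=> y; have [Ay|nAy] := pselect (A y); last by exists y.
  by have [z Kz zy] := AK y Ay; exists z.
have [|p [Kp clp]] := cK (z @ F) _.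
  by rewrite /nbhs/=; apply: filterS FA => y /zP[].
exists p => //.
have [Fb|Fnb] := in_ultra_setVsetC (z @^-1` (ball p e)) FF.
  apply: filterS (filterI FA Fb) => y [/zP[_ zy] /= /ball_mdist pz].
  by apply/ball_mdist; have := metric_triangle p (z y) y; lra.
have [y [/= npy py]] := clp (~` ball p e) (ball p e) Fnb (nbhsx_ballx p e e0).
by [].
Qed.

Hypothesis lcX : locally_compact [set: X].
Hypothesis interp : forall (x y : X) r eta, 0 < r -> r < mdist x y -> 0 < eta ->
  exists2 z, mdist x z <= r & mdist z y < mdist x y - r + eta.

Let interp_ball (x y : X) r s eta : 0 < r -> r <= s -> 0 < eta ->
  mdist x y <= s -> exists2 z, mclosed_ball x r z & mdist z y < s - r + eta.
Proof.
move=> r0 rs eta0 xys; have [ry|yr] := leP (mdist x y) r.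
  by exists y => //; rewrite mdistxx; lra.
have [z xz zy] := interp r0 yr eta0.
by exists z => //; lra.
Qed.

Let compact_mclosed_ball_le (x y : X) r s : mdist x y + s <= r ->
  compact (mclosed_ball x r) -> compact (mclosed_ball y s).
Proof.
move=> xyr cr; apply: subclosed_compact cr _; first exact: closed_mclosed_ball.
by move=> z; rewrite /mclosed_ball /=; have := metric_triangle x y z; lra.
Qed.

Let compact_small (x : X) : exists2 r, 0 < r & compact (mclosed_ball x r).
Proof.
have [U xU [cU clU]] := lcX (Logic.I : [set: X] x).
have {}xU : nbhs x U by apply: (@filterS _ (nbhs x) _ _ _ _ xU) => y; exact.
have /nbhs_ballP[r /= r0 xr] := xU.
exists (r / 2); first by rewrite divr_gt0.
apply: subclosed_compact cU _; first exact: closed_mclosed_ball.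
move=> y; rewrite /mclosed_ball/= => xy; apply: xr; apply/ball_mdist; lra.
Qed.

(** The ball of radius [s] lies in arbitrarily small neighbourhoods of smaller compact balls, so
    every ultrafilter on it is Cauchy, and completeness gives the limit. *)
Let compact_sup (x : X) s : 0 < s ->
  (forall r, 0 < r -> r < s -> compact (mclosed_ball x r)) ->
  compact (mclosed_ball x s).
Proof.
move=> s0 cr; rewrite compact_ultra => F FF Fs.
have : cauchy F.
  apply: cauchy_exP => e e0.
  (* The term [s / 2] only keeps the radius positive. *)
  pose r := Num.max (s / 2) (s - e / 8).
  have r0 : 0 < r by rewrite /r lt_max; apply/orP; left; lra.
  have rs : r < s by rewrite /r gt_max; apply/andP; split; lra.
  have re : s - e / 8 <= r by rewrite /r le_max lexx orbT.
  have [|y sy|p _ Fp] := compact_near_ultra (cr r r0 rs) (_ : 0 < e / 2) FF Fs.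
  - lra.
  - have e8 : 0 < e / 8 by lra.
    have [z xz zy] := interp_ball r0 (ltW rs) e8 sy.
    by exists z => //; lra.
  - by exists p; rewrite mulrC divfK in Fp.
move=> /cauchy_cvg/cvg_ex[l Fl]; exists l; split => //.
exact: (@closed_cvg _ _ F _ id _ (@closed_mclosed_ball x s) Fs l Fl).
Qed.

(** Local compactness gives one radius [e] for which all balls centred in the compact ball are
    compact. An ultrafilter on the slightly larger ball concentrates in one of them. *)
Let compact_next (x : X) r : 0 < r -> compact (mclosed_ball x r) ->
  exists2 s, r < s & compact (mclosed_ball x s).
Proof.
move=> r0 cr.
have [e e0 ce] : exists2 e, 0 < e &
    forall y, mclosed_ball x r y -> compact (mclosed_ball y e).
  have /compact_near_coveringP/(_ R (0^'+)
    (fun e y => compact (mclosed_ball y e))) := cr.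
  move=> /(_ _ _)[y _|e0 /= e0' h].
  - have [d d0 cd] := compact_small y.
    exists (ball y (d / 2), [set e | e < d / 2]).
      split; first by apply: nbhsx_ballx; lra.
      by apply: nbhs_right_lt; lra.
    move=> [z e] /= [/ball_mdist yz ed]; apply: compact_mclosed_ball_le cd; lra.
  - exists (e0 / 2); first by rewrite divr_gt0.
    apply: h; last by rewrite divr_gt0.
    by rewrite /ball_ /= sub0r normrN gtr0_norm; lra.
exists (r + e / 8); first lra.
rewrite compact_ultra => F FF Fs.
have [|y sy|p Kp Fp] := compact_near_ultra cr (_ : 0 < e / 2) FF Fs.
- lra.
- have e8 : 0 < e / 8 by lra.
  have rs : r <= r + e / 8 by lra.
  have [z xz zy] := interp_ball r0 rs e8 sy.
  by exists z => //; lra.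
have := ce _ Kp; rewrite compact_ultra => /(_ F FF)[].
  by apply: filterS Fp => y /ball_mdist; rewrite /mclosed_ball/=; lra.
move=> l [_ Fl]; exists l; split => //.
exact: (@closed_cvg _ _ F _ id _ (@closed_mclosed_ball x (r + e / 8)) Fs l Fl).
Qed.

(** If the radii of compact balls were bounded, their supremum would be attained by [compact_sup]
    and exceeded by [compact_next]. *)
Lemma compact_mclosed_ball (x : X) r : compact (mclosed_ball x r).
Proof.
pose S := [set r | 0 < r /\ compact (mclosed_ball x r)].
have S0 : S !=set0 by have [r' ? ?] := compact_small x; exists r'.
have [Sub|nSub] := pselect (has_ubound S).
  have supS : has_sup S by [].
  have s0 : 0 < sup S.
    have [r' [r'0 cr']] := S0; apply: (lt_le_trans r'0).
    exact: (sup_upper_bound supS (conj r'0 cr')).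
  have cs : compact (mclosed_ball x (sup S)).
    apply: compact_sup => // r' r'0 /(sup_gt S0)[r'' [_ cr''] rr''].
    by apply: compact_mclosed_ball_le cr''; rewrite mdistxx add0r ltW.
  have [s ss cs'] := compact_next s0 cs.
  have : s <= sup S by apply: (sup_upper_bound supS); split => //; exact: lt_trans ss.
  by rewrite leNgt ss.
have [r' [_ cr'] rr'] : exists2 r', S r' & r < r'.
  apply: contrapT => h; apply: nSub; exists r => r' Sr'.
  by rewrite leNgt; apply/negP => rr'; apply: h; exists r'.
by apply: compact_mclosed_ball_le cr'; rewrite mdistxx add0r ltW.
Qed.

End hopf_rinow.

Section proper.
Context {R : realType} {X : completeMetricType R}.
Variable m : {measure set (borel X) -> \bar R}.
Hypothesis mmsX : metric_measure_space m.

Lemma ball_measure_fin_num (x : X) r : m (ball x r) \is a fin_num.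
Proof.
have [_ _ fin _] := mmsX.
by rewrite ge0_fin_numE// fin//; [exact: ball_borel|exists x, r].
Qed.

Lemma ball_measure_gt0 (x : X) r : (0 < r)%R -> 0 < m (ball x r).
Proof.
move=> r0; have [_ _ _ supp] := mmsX.
have : msupport m x by rewrite supp.
apply; first exact: ball_open_mdist.
by apply/ball_mdist; rewrite mdistxx.
Qed.

Definition uniform_density (A : set (borel X)) (x : borel X) : R :=
  (\1_A x * (fine (m A))^-1)%R.

Lemma measurable_uniform_density A : measurable A ->
  measurable_fun setT (uniform_density A).
Proof.
by move=> mA; apply: measurable_funM => //; exact: measurable_indic.
Qed.

Lemma uniform_density_ge0 A x : (0 <= uniform_density A x)%R.
Proof. by rewrite mulr_ge0// invr_ge0 fine_ge0. Qed.

Lemma integral_uniform_density A B : measurable A -> measurable B ->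
  \int[m]_(x in B) (uniform_density A x)%:E =
  ((fine (m A))^-1)%:E * m (A `&` B).
Proof.
move=> mA mB.
under eq_integral do rewrite EFinM muleC.
rewrite ge0_integralZl//.
- by rewrite integral_indic.
- by apply/measurable_EFinP; exact: measurable_indic.
Qed.

Lemma integralT_uniform_density A : measurable A -> 0 < m A ->
  m A \is a fin_num -> \int[m]_x (uniform_density A x)%:E = 1.
Proof.
move=> mA mA0 mAfin; rewrite integral_uniform_density// setIT.
rewrite -[X in _ * X]fineK// -EFinM mulVf// gt_eqF//.
by rewrite fine_gt0// mA0 ltey_eq mAfin.
Qed.

Lemma coupling_near mu nu (g : {measure set (borel X * borel X)%type -> \bar R})
    (F Z : set (borel X)) r delta :
  coupling mu nu g -> measurable F -> measurable Z -> mu (~` F) = 0 ->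
  g [set p | (r <= mdist (p.1 : X) (p.2 : X))%R] <= delta ->
  (forall x z : X, F x -> (mdist x z < r)%R -> Z z) ->
  nu (~` Z) <= delta.
Proof.
move=> gc mF mZ muF gr FZ; have [_ sepX _ _] := mmsX.
have mr : measurable [set p : borel X * borel X |
    (r <= mdist (p.1 : X) (p.2 : X))%R].
  have := mdist_measurable sepX measurableT (measurable_itv `[r, +oo[).
  rewrite setTI; congr measurable.
  by apply/seteqP; split=> p /=; rewrite in_itv/= andbT.
rewrite -(gc _ (measurableC mZ)).2.
have mFc : measurable (~` F `*` setT : set (borel X * borel X)).
  by apply: measurableX => //; exact: measurableC.
apply: (@le_trans _ _ (g ((~` F `*` setT) `|`
    [set p | (r <= mdist (p.1 : X) (p.2 : X))%R]))).
  rewrite le_measure ?inE//.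
  - by apply: measurableX => //; exact: measurableC.
  - exact: measurableU.
  - move=> [x z] [_ /= nZ]; have [Fx|nFx] := pselect (F x); last by left.
    by right; rewrite /= leNgt; apply/negP => xz; apply: nZ; exact: FZ xz.
apply: le_trans (measureU2 _ mFc mr) _.
rewrite [X in X + _](_ : _ = 0) ?add0e//.
exact: eq_trans (gc _ (measurableC mF)).1 muF.
Qed.

Lemma coupling_near_sym mu nu
    (g : {measure set (borel X * borel X)%type -> \bar R})
    (F Z : set (borel X)) r delta :
  coupling nu mu g -> measurable F -> measurable Z -> mu (~` F) = 0 ->
  g [set p | (r <= mdist (p.1 : X) (p.2 : X))%R] <= delta ->
  (forall x z : X, F x -> (mdist x z < r)%R -> Z z) ->
  nu (~` Z) <= delta.
Proof.
move=> gc mF mZ muF gr FZ.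
have mswap : measurable_fun setT (fun p : borel X * borel X => (p.2, p.1)).
  by apply: measurable_fun_pair.
have [g' g'E] := image_measure g mswap.
apply: (@coupling_near mu nu g' F Z r) => //.
  move=> A mA; rewrite !g'E; have [gA1 gA2] := gc _ mA; split.
    by rewrite -gA2; congr (g _); apply/seteqP; split=> -[? ?] [].
  by rewrite -gA1; congr (g _); apply/seteqP; split=> -[? ?] [].
rewrite g'E; apply: le_trans gr; rewrite le_eqVlt; apply/orP; left; apply/eqP.
by congr (g _); apply/seteqP; split=> -[x y]/=; rewrite metric_sym.
Qed.

Variable n : R.
Hypothesis CDX : CD0 m n.

(** Apply the curvature condition to uniform measures on small balls around [x] and [y]. At time [t]
    all but mass 1/3 lies near [x], at the scale t d(x, y), and all but mass 1/3 lies near [y], at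
    the scale (1 - t) d(x, y); as 2/3 < 1, the two balls meet. *)
Lemma approx_geodesic (x y : X) t e : (0 < t < 1)%R -> (0 < e)%R ->
  exists2 z : X, (mdist x z < t * mdist x y + e)%R &
                 (mdist z y < (1 - t) * mdist x y + e)%R.
Proof.
move=> t01 e0; have /andP[t0 t1] := t01; have [_ sepX _ _] := mmsX.
pose r := (e / 8)%R; have r0 : (0 < r)%R by rewrite /r; lra.
pose ud (w : X) := uniform_density (ball w r).
have mb w : measurable (ball w r : set (borel X)) by exact: ball_borel.
have udb w : mbounded [set z : X | ud w z != 0%R].
  exists w, r => z; rewrite /ud /uniform_density/= indicE.
  by have [/set_mem//|_] := boolP (z \in _); rewrite mul0r eqxx.
have iud w : \int[m]_z (ud w z)%:E = 1.
  apply: integralT_uniform_density => //; first exact: ball_measure_gt0.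
  exact: ball_measure_fin_num.
have [mu_ [geo mu0 mu1 _]] := CD0_densities CDX
  (measurable_uniform_density (mb x)) (uniform_density_ge0 (ball x r)) (iud x)
  (measurable_uniform_density (mb y)) (uniform_density_ge0 (ball y r)) (iud y)
  (udb x) (udb y).
have N0 : mu_ 0%R (~` ball x r) = 0.
  rewrite mu0; last exact: measurableC.
  rewrite integral_uniform_density//; last exact: measurableC.
  by rewrite setICr measure0 mule0.
have N1 : mu_ 1%R (~` ball y r) = 0.
  rewrite mu1; last exact: measurableC.
  rewrite integral_uniform_density//; last exact: measurableC.
  by rewrite setICr measure0 mule0.
pose L := (mdist x y + 2 * r)%R.
have xyL (u v : X) : ball x r u -> ball y r v -> (mdist u v <= L)%R.
  move=> /ball_mdist xu /ball_mdist yv; rewrite /L.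
  have := metric_triangle u x v; have := metric_triangle x y v.
  by rewrite (metric_sym u x); lra.
have e4 : (0 < e / 4)%R by lra.
have d3 : (0 < 3^-1 :> R)%R by lra.
have [g1 [g2 [gc1 gc2 G1 G2]]] :=
  displacement sepX geo (mb x) (mb y) N0 N1 xyL t01 e4 d3.
pose Z1 : set (borel X) := ball x (r + (t * L + e / 4)).
pose Z2 : set (borel X) := ball y (r + ((1 - t) * L + e / 4)).
have mZ1 : measurable Z1 by exact: ball_borel.
have mZ2 : measurable Z2 by exact: ball_borel.
have H1 : mu_ t (~` Z1) <= 3^-1%:E.
  apply: (coupling_near gc1 (mb x) mZ1 N0 G1) => u z /ball_mdist xu uz.
  by apply/ball_mdist; have := metric_triangle x u z; lra.
have H2 : mu_ t (~` Z2) <= 3^-1%:E.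
  apply: (coupling_near_sym gc2 (mb y) mZ2 N1 G2) => u z /ball_mdist yu uz.
  by apply/ball_mdist; have := metric_triangle y u z; lra.
have Lr (s : R) : (0 < s < 1 -> r + (s * L + e / 4) <= s * mdist x y + e)%R.
  by move=> /andP[s0 s1]; rewrite /L /r; nra.
have [[z [/ball_mdist xz /ball_mdist yz]]|Z12] := pselect (Z1 `&` Z2 !=set0).
  exists z; first by apply: lt_le_trans xz _; exact: Lr.
  rewrite metric_sym; apply: lt_le_trans yz _; apply: Lr.
  by apply/andP; split; lra.
have : 1 <= 3^-1%:E + 3^-1%:E :> \bar R.
  rewrite -(probability_setT (mu_ t)).
  apply: le_trans (leeD H1 H2).
  apply: le_trans (measureU2 _ (measurableC mZ1) (measurableC mZ2)).
  rewrite le_measure ?inE//; first by apply: measurableU; exact: measurableC.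
  move=> z _; have [Z1z|] := pselect (Z1 z); last by left.
  by right => Z2z; apply: Z12; exists z.
by rewrite -EFinD lee_fin; lra.
Qed.

Lemma compact_mclosed_ball_CD0 (x : X) r : compact (mclosed_ball x r).
Proof.
have [lcX _ _ _] := mmsX; apply: compact_mclosed_ball => // {}x y {}r eta r0 rxy eta0.
(* Aiming at the distance [r - e] absorbs the error [e] on the side of [x], where the bound must be
   exactly [r]; the bound [r / 4] keeps [r - e] positive. *)
pose e := (Num.min eta r / 4)%R.
have e0 : (0 < e)%R by rewrite /e divr_gt0// lt_min eta0.
have ee : (e <= eta / 4)%R by rewrite /e ler_pM2r// ge_min lexx.
have er : (e <= r / 4)%R by rewrite /e ler_pM2r// ge_min lexx orbT.
have d0 : (0 < mdist x y)%R by exact: lt_trans rxy.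
have t01 : (0 < (r - e) / mdist x y < 1)%R.
  by rewrite divr_gt0 ?ltr_pdivrMr//=; lra.
have [z xz zy] := approx_geodesic x y t01 e0.
exists z; first by move: xz; rewrite divfK ?gt_eqF//; lra.
by move: zy; rewrite mulrBl mul1r divfK ?gt_eqF//; lra.
Qed.

End proper.

(** * Transport to a large ball *)

(* The tangent line of the concave function [s `^ (1 - n^-1)] at the point
   [w `^ (n / (n - 1)) / Z]. *)
Lemma powR_tangent (R : realType) (n Z w s : R) : (1 < n -> 0 < Z -> 0 < w -> 0 <= s ->
  s `^ (1 - n^-1) <= n^-1 * Z `^ (- (1 - n^-1)) * w +
    (1 - n^-1) * Z `^ n^-1 * w `^ (- (n - 1)^-1) * s)%R.
Proof.
move=> n1 Z0 w0 s0.
have n0 : (0 < n)%R by lra.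
have ni0 : (0 < n^-1)%R by rewrite invr_gt0.
have ni1 : (n^-1 < 1)%R by rewrite invf_lt1.
pose q : R := (1 - n^-1)%R; have q0 : (0 < q)%R by rewrite /q subr_gt0.
pose a := ((w `^ (- (n - 1)^-1) * Z `^ n^-1 * s) `^ q)%R.
pose b := ((w * Z `^ (- q)) `^ n^-1)%R.
have qi0 : (0 < q^-1)%R by rewrite invr_gt0.
have := @conjugate_powR R a b q^-1%R n (powR_ge0 _ _) (powR_ge0 _ _) qi0 n0.
rewrite invrK /q subrK => /(_ erefl); rewrite -/q.
have -> : (a `^ q^-1 = w `^ (- (n - 1)^-1) * Z `^ n^-1 * s)%R.
  rewrite /a -powRrM mulfV ?gt_eqF// powRr1//.
  by rewrite !mulr_ge0// powR_ge0.
have -> : (b `^ n = w * Z `^ (- q))%R.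
  rewrite /b -powRrM mulVf ?gt_eqF// powRr1//.
  by rewrite mulr_ge0// ?powR_ge0// ltW.
have -> : (a * b = s `^ q)%R.
  have wk : (w `^ (- (n - 1)^-1) `^ q * w `^ n^-1 = 1)%R.
    rewrite -powRrM -powRD; last by rewrite (gt_eqF w0) implybT.
    rewrite (_ : _ + _ = 0)%R ?powRr0//.
    by rewrite /q; field; apply/andP; split; lra.
  have Zk : (Z `^ n^-1 `^ q * Z `^ (- q) `^ n^-1 = 1)%R.
    rewrite -!powRrM -powRD; last by rewrite (gt_eqF Z0) implybT.
    by rewrite (_ : _ + _ = 0)%R ?powRr0//; ring.
  have cancel2 (W1 W2 Z1 Z2 S : R) :
      (W1 * W2 = 1 -> Z1 * Z2 = 1 -> W1 * Z1 * S * (W2 * Z2) = S)%R.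
    move=> h1 h2; transitivity (W1 * W2 * (Z1 * Z2) * S)%R; first by ring.
    by rewrite h1 h2 !mul1r.
  have w0' := ltW w0.
  rewrite /a /b !powRM ?mulr_ge0 ?powR_ge0//.
  exact: cancel2.
move=> /le_trans; apply; rewrite addrC.
have reorder (W A B C S N Q : R) :
    (W * C * N + A * B * S * Q = N * C * W + Q * B * A * S)%R by ring.
by rewrite reorder.
Qed.

Section transport.
Context {R : realType} {X : completeMetricType R}.
Variable m : {measure set (borel X) -> \bar R}.

(** The singular part only adds to the right-hand side, as [h] is nonnegative. *)
Lemma integral_ac_density_le (mu : probability (borel X) R) rho
    (h : borel X -> \bar R) :
  is_ac_density m mu rho -> measurable_fun setT h -> (forall x, 0 <= h x) ->
  \int[m]_x (h x * (rho x)%:E) <= \int[mu]_x h x.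
Proof.
move=> [mrho rho0 [nu [_ nuE]]] mh h0.
pose M : {measure set (borel X) -> \bar R} := mdensity m mrho rho0.
rewrite -(integral_mdensity _ mrho rho0 mh h0).
rewrite [leRHS](eq_measure_integral (measure_add M nu)); last first.
  by move=> A mA _; exact: eq_trans (nuE A mA) (esym (measure_addE M nu A)).
rewrite ge0_integral_measure_add// leeDl//.
exact: integral_ge0.
Qed.

(** Along pairs at distance less than [eps], [h] at the target is bounded by [h0] at the source. The
    remaining pairs have mass at most [delta], where the bound [H] limits the loss to
    [H * delta]. *)
Lemma transport_le (mu nu : probability (borel X) R) (eps H : R)
    (h h0 : borel X -> \bar R) :
  separable X ->
  (forall delta, (0 < delta)%R ->
    exists2 g : {finite_measure set (borel X * borel X)%type -> \bar R},
      coupling mu nu g &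
      g [set p | (eps <= mdist (p.1 : X) (p.2 : X))%R] <= delta%:E) ->
  measurable_fun setT h -> (forall x, 0 <= h x <= H%:E) ->
  measurable_fun setT h0 -> (forall x, 0 <= h0 x) ->
  (forall x z : X, (mdist x z < eps)%R -> h z <= h0 x) ->
  \int[nu]_z h z <= \int[mu]_x h0 x.
Proof.
move=> sepX near mh hH mh0 h00 hh0.
have H0 : (0 <= H)%R.
  by have /andP[a b] := hH point; rewrite -lee_fin; exact: le_trans b.
apply/lee_addgt0Pr => e e0.
have [|g gc gd] := near (e / (H + 1))%R; first by rewrite divr_gt0// ltr_wpDl.
pose B : set (borel X * borel X) :=
  [set p | (eps <= mdist (p.1 : X) (p.2 : X))%R].
have mB : measurable B.
  have := mdist_measurable sepX measurableT (measurable_itv `[eps, +oo[).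
  rewrite setTI; congr measurable.
  by apply/seteqP; split=> p /=; rewrite in_itv/= andbT.
rewrite (@integral_image_measure _ _ _ _ _ g snd measurable_snd nu)//; last 2 first.
- by move=> A mA; rewrite -setTX; exact/esym/(gc A mA).2.
- by move=> y; have /andP[] := hH y.
rewrite (@integral_image_measure _ _ _ _ _ g fst measurable_fst mu)//; last first.
  by move=> A mA; rewrite -setXT; exact/esym/(gc A mA).1.
have mf1 : measurable_fun setT (fun p : borel X * borel X => h p.2).
  exact: (measurableT_comp mh measurable_snd).
have mf0 : measurable_fun setT (fun p : borel X * borel X => h0 p.1).
  exact: (measurableT_comp mh0 measurable_fst).
have mI : measurable_fun setT (fun p : borel X * borel X => (\1_B p)%:E : \bar R).
  by apply/measurable_EFinP; exact: measurable_indic.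
apply: (@le_trans _ _ (\int[g]_p (h0 p.1 + H%:E * (\1_B p)%:E))).
  apply: ge0_le_integral => //.
  - by move=> p _; have /andP[] := hH p.2.
  - by apply: emeasurable_funD => //; exact: measurable_funeM.
  - move=> p _; rewrite indicE; have [pB|pB] := boolP (p \in B).
      by rewrite mule1; have /andP[_ h2] := hH p.2; rewrite (le_trans h2)// leeDr.
    rewrite mule0 adde0; apply: hh0; rewrite ltNge; apply/negP => pB'.
    by move/negP: pB; apply; rewrite inE.
rewrite ge0_integralD//; last 2 first.
- by move=> p _; rewrite mule_ge0// lee_fin.
- exact: measurable_funeM.
rewrite leeD2l// ge0_integralZl//.
rewrite integral_indic// setIT.
apply: (@le_trans _ _ (H%:E * (e / (H + 1))%:E)); first by rewrite lee_wpmul2l// lee_fin.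
rewrite -EFinM lee_fin mulrA ler_pdivrMr ?ltr_wpDl//; nra.
Qed.

End transport.

Section transport_sobolev.
Context {R : realType} {X : completeMetricType R}.
Variable m : {measure set (borel X) -> \bar R}.
Hypothesis mmsX : metric_measure_space m.
Variable n : R.
Hypothesis n_gt1 : (1 < n)%R.
Hypothesis CDX : CD0 m n.

Let p : R := (n / (n - 1))%R.
Let q : R := (1 - n^-1)%R.

Let n0 : (0 < n)%R. Proof. exact: lt_trans n_gt1. Qed.

Let nm1 : (0 < n - 1)%R. Proof. by rewrite subr_gt0. Qed.

Let pq : (p * q = 1)%R.
Proof. by rewrite /p /q; field; rewrite !gt_eqF. Qed.

Let q0 : (0 < q)%R.
Proof. by rewrite /q subr_gt0 invf_lt1. Qed.

Variables (x0 : X) (r0 eps : R) (u v : borel X -> R).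
Hypothesis mu : measurable_fun setT u.
Hypothesis u0 : forall x, (0 <= u x)%R.
Hypothesis usupp : forall x : X, u x != 0%R -> ball x0 r0 x.
Hypothesis mv : measurable_fun setT v.
Hypothesis v0 : forall x, (0 <= v x)%R.
Hypothesis uv : forall x z : X, (mdist x z < eps)%R -> (u x <= v z)%R.
Variables (U V Z : R).
Hypothesis UE : \int[m]_x (u x)%:E = U%:E.
Hypothesis VE : \int[m]_x (v x)%:E = V%:E.
Hypothesis ZE : \int[m]_x (u x `^ p)%:E = Z%:E.
Hypothesis Z0 : (0 < Z)%R.

Let U0 : (0 <= U)%R.
Proof. by rewrite -lee_fin -UE; apply: integral_ge0 => x _; rewrite lee_fin. Qed.

Let f0 (x : borel X) : R := (u x `^ p * Z^-1)%R.

Let mf0 : measurable_fun setT f0.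
Proof.
by apply: measurable_funM => //; exact: measurableT_comp (measurable_powR _) _.
Qed.

Let f00 x : (0 <= f0 x)%R.
Proof. by rewrite mulr_ge0 ?powR_ge0// invr_ge0 ltW. Qed.

Let p_neq0 : p != 0%R.
Proof. by apply: contra_eq_neq pq => ->; rewrite mul0r eq_sym oner_eq0. Qed.

Let f0_supp x : f0 x != 0%R -> ball x0 r0 x.
Proof.
move=> f0x; apply: usupp; apply: contra_neq f0x => ux.
by rewrite /f0 ux powR0// mul0r.
Qed.

Let If0 : \int[m]_x (f0 x)%:E = 1.
Proof.
under eq_integral do rewrite /f0 EFinM.
rewrite ge0_integralZr//.
- by rewrite ZE -EFinM mulfV// gt_eqF.
- by apply/measurable_EFinP; exact: measurableT_comp (measurable_powR _) _.
- by move=> x _; rewrite lee_fin powR_ge0.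
- by rewrite lee_fin invr_ge0 ltW.
Qed.

Let If0q : \int[m]_x (f0 x `^ q)%:E = (Z `^ (- q) * U)%:E.
Proof.
have f0qE x : (f0 x `^ q = Z `^ (- q) * u x)%R.
  rewrite /f0 powRM ?powR_ge0 ?invr_ge0 ?(ltW Z0)//.
  by rewrite -powRrM pq powRr1// -powR_inv1 ?(ltW Z0)// -powRrM mulN1r mulrC.
under eq_integral do rewrite f0qE EFinM.
rewrite ge0_integralZl//.
- by rewrite UE EFinM.
- exact/measurable_EFinP.
- by move=> x _; rewrite lee_fin.
- by rewrite lee_fin powR_ge0.
Qed.

Section entropy_bound.
Variables mu0 mut : probability (borel X) R.
Hypothesis mu0E : forall A, measurable A -> mu0 A = \int[m]_(x in A) (f0 x)%:E.
Hypothesis near : forall delta, (0 < delta)%R ->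
  exists2 g : {finite_measure set (borel X * borel X)%type -> \bar R},
    coupling mu0 mut g &
    g [set p | (eps <= mdist (p.1 : X) (p.2 : X))%R] <= delta%:E.

Let integral_mu0 h : measurable_fun setT h -> (forall x, 0 <= h x) ->
  \int[mu0]_x h x = \int[m]_x (h x * (f0 x)%:E).
Proof.
move=> mh h0; rewrite -(integral_mdensity _ mf0 f00 mh h0).
by apply: eq_measure_integral => A mA _; exact: mu0E.
Qed.

Let K : set (borel X) := ball x0 (r0 + eps).

Let mK : measurable K. Proof. exact: ball_borel. Qed.

(** For each [delta] only mass [delta] moves [eps] or more, so no mass at all leaves the
    [eps]-neighbourhood: this is [transport_le] for indicators of complements. It confines the
    entropy integral to a set of finite measure. *)
Let mut_K : mut (~` K) = 0.
Proof.
have [_ sepX _ _] := mmsX.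
have mC (A : set (borel X)) : measurable A ->
    measurable_fun setT (fun x : borel X => (\1_(~` A) x)%:E : \bar R).
  by move=> mA; apply/measurable_EFinP; apply: measurable_indic; exact: measurableC.
have mb : measurable (ball x0 r0 : set (borel X)) by exact: ball_borel.
have mu0b : mu0 (~` ball x0 r0) = 0.
  rewrite mu0E; last exact: measurableC.
  apply: integral0_eq => x nx; have [->//|/eqP/f0_supp] := pselect (f0 x = 0%R).
  by move=> /nx.
have ind (M : probability (borel X) R) (A : set (borel X)) : measurable A ->
    \int[M]_x (\1_(~` A) x)%:E = M (~` A).
  by move=> mA; rewrite integral_indic ?setIT//; exact: measurableC.
suff : mut (~` K) <= 0 by rewrite measure_le0 => /eqP.
rewrite -(ind _ _ mK) -[leRHS]mu0b -(ind _ _ mb).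
apply: (@transport_le _ _ mu0 mut eps 1) => //; [exact: mC| |exact: mC|].
- by move=> x; rewrite !lee_fin indicE ler0n lern1 leq_b1.
- move=> x z xz; rewrite lee_fin !indicE.
  have [zK|//] := boolP (z \in ~` K); rewrite mem_set//= => /ball_mdist x0x.
  move/set_mem: zK; apply; apply/ball_mdist.
  by have := metric_triangle x0 x z; lra.
Qed.

Let entropy_eta eta : (0 < eta)%R ->
  \int[m]_x (ac_density m mut x `^ q)%:E <=
    (n^-1 * Z `^ (- q) * (V + eta * fine (m K)) + q * Z `^ (- q) * U)%:E.
Proof.
move=> eta0; have [_ sepX _ _] := mmsX.
set rho := ac_density m mut.
have Zq0 : (0 <= Z `^ (- q))%R by exact: powR_ge0.
have V0 : (0 <= V)%R.
  by rewrite -lee_fin -VE; apply: integral_ge0 => x _; rewrite lee_fin.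
have ni0 : (0 <= n^-1)%R by rewrite invr_ge0 ltW.
(* Without a Lebesgue decomposition, [ac_density] takes its default value 0 and the left-hand side
   is zero. *)
have [[rho' rhoP]|nrho] := pselect (exists rho, is_ac_density m mut rho); last first.
  have -> : rho = cst 0%R.
    by apply: xgetPN => rho' rhoP; apply: nrho; exists rho'.
  under eq_integral do rewrite /cst powR0 ?gt_eqF//.
  rewrite integral0 lee_fin.
  have k0 : (0 <= fine (m K))%R by exact: fine_ge0.
  have eta0' := ltW eta0; have q0' := ltW q0.
  by rewrite addr_ge0// mulr_ge0 ?addr_ge0// ?mulr_ge0.
have {rho' rhoP} rhoac : is_ac_density m mut rho.
  exact: (xgetPex (cst 0%R) (ex_intro _ rho' rhoP)).
have [mrho rho0 [nu [_ nuE]]] := rhoac.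
pose h (w : borel X -> R) (x : borel X) : R := ((w x + eta) `^ (- (n - 1)^-1))%R.
have mh w : measurable_fun setT w -> measurable_fun setT (h w).
  move=> mw; apply: (measurableT_comp (measurable_powR _)).
  exact: measurable_funD.
have h0 w x : (0 <= h w x)%R by exact: powR_ge0.
have hE w : measurable_fun setT w -> measurable_fun setT (fun x => (h w x)%:E).
  by move=> mw; apply/measurable_EFinP; exact: mh.
have powRN_le (a b : R) : (0 < a -> a <= b ->
    b `^ (- (n - 1)^-1) <= a `^ (- (n - 1)^-1))%R.
  move=> a0 ab; rewrite !powRN lef_pV2 ?posrE ?powR_gt0 ?(lt_le_trans a0)//.
  by rewrite ge0_ler_powR// ?nnegrE ?invr_ge0 ?subr_ge0 ?ltW// (lt_le_trans a0).
(* The exponent is negative, so [u x <= v z] gives [h v z <= h u x], and the integral passes from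
   [mut] to [mu0]. There [u]^ (- (n - 1)^-1) * u [^ p = u]. *)
have hrho : \int[m]_x ((h v x)%:E * (rho x)%:E) <= (U / Z)%:E.
  apply: le_trans (integral_ac_density_le rhoac (hE _ mv) _) _ => //.
    by move=> x; rewrite lee_fin.
  apply: le_trans (@transport_le _ _ mu0 mut eps (eta `^ (- (n - 1)^-1)) _
    (fun x => (h u x)%:E) sepX near (hE _ mv) _ (hE _ mu) _ _) _.
  - move=> x; rewrite !lee_fin h0 /h; apply: powRN_le => //.
    by rewrite lerDr.
  - by move=> x; rewrite lee_fin.
  - move=> x z xz; rewrite lee_fin; apply: powRN_le.
      by rewrite ltr_wpDl.
    by rewrite lerD2r; exact: uv.
  rewrite integral_mu0; [|exact: hE|by move=> x; rewrite lee_fin].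
  rewrite EFinM -UE -ge0_integralZr//; last 3 first.
  - exact/measurable_EFinP.
  - by move=> x _; rewrite lee_fin.
  - by rewrite lee_fin invr_ge0 ltW.
  apply: ge0_le_integral => //.
  - by move=> x _; rewrite mule_ge0// lee_fin.
  - by apply: emeasurable_funM; [exact: hE|exact/measurable_EFinP].
  - by apply: emeasurable_funM => //; exact/measurable_EFinP.
  - move=> x _; rewrite -!EFinM lee_fin /f0 mulrA ler_pM2r ?invr_gt0//.
    have [ux|ux] := eqVneq (u x) 0%R; first by rewrite ux powR0// mulr0.
    have ux0 : (0 < u x)%R by rewrite lt_neqAle eq_sym ux u0.
    apply: (@le_trans _ _ (u x `^ (- (n - 1)^-1) * u x `^ p)%R).
      by rewrite ler_wpM2r ?powR_ge0// /h powRN_le// lerDl ltW.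
    rewrite -powRD; last by rewrite (gt_eqF ux0) implybT.
    rewrite (_ : _ + _ = 1)%R ?powRr1//.
    by rewrite /p; field; rewrite gt_eqF.
have mrq : measurable_fun setT (fun x => (rho x `^ q)%:E).
  by apply/measurable_EFinP; exact: measurableT_comp (measurable_powR _) _.
have mrE : measurable_fun setT (fun x => (rho x)%:E) by exact/measurable_EFinP.
have mvE : measurable_fun setT (fun x => (v x)%:E) by exact/measurable_EFinP.
have rhoK : \int[m]_(x in ~` K) (rho x `^ q)%:E = 0.
  have : \int[m]_(x in ~` K) (rho x)%:E = 0.
    apply/eqP; rewrite eq_le integral_ge0 ?andbT; last first.
      by move=> x _; rewrite lee_fin.
    by rewrite -mut_K nuE ?leeDl//; exact: measurableC.
  have -> : \int[m]_(x in ~` K) (rho x)%:E = \int[m]_(x in ~` K) `|(rho x)%:E|.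
    by apply: eq_integral => x _; rewrite gee0_abs// lee_fin.
  move/(ae_eq_integral_abs m (measurableC mK)) => /(_ (measurable_funTS mrE)) ae0.
  rewrite -(integral0 m (~` K)); apply: ge0_ae_eq_integral => //.
  - exact: measurableC.
  - exact: measurable_funTS.
  - by move=> x _; rewrite lee_fin powR_ge0.
  - by apply: filterS ae0 => x /= + Kx => /(_ Kx) [] ->; rewrite powR0// gt_eqF.
rewrite -(setUv K) ge0_integral_setU//; last 4 first.
- exact: measurableC.
- by rewrite setUv.
- by move=> x _; rewrite lee_fin powR_ge0.
- by rewrite disj_set2E setICr.
rewrite rhoK adde0.
have -> : (q * Z `^ (- q) * U = q * Z `^ n^-1 * (U / Z))%R.
  rewrite /q opprB powRB; last by rewrite (gt_eqF Z0) implybT.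
  by rewrite powRr1 ?(ltW Z0)//; ring.
have [a aE] : exists a, a = (n^-1 * Z `^ (- q))%R by eexists.
have [b bE] : exists b, b = (q * Z `^ n^-1)%R by eexists.
have a0 : (0 <= a)%R by rewrite aE mulr_ge0.
have b0 : (0 <= b)%R by rewrite bE mulr_ge0// ?powR_ge0// ltW.
rewrite -aE -bE.
apply: (@le_trans _ _ (\int[m]_(x in K)
    (a%:E * ((v x)%:E + eta%:E) + b%:E * ((h v x)%:E * (rho x)%:E)))).
  apply: ge0_le_integral => //.
  - by move=> x _; rewrite lee_fin powR_ge0.
  - exact: measurable_funTS.
  - apply: measurable_funTS; apply: emeasurable_funD; apply: measurable_funeM.
      exact: emeasurable_funD.
    by apply: emeasurable_funM => //; exact: hE.
  - move=> x _.
    suff : (rho x `^ q <= a * (v x + eta) + b * (h v x * rho x))%R by [].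
    have w0 : (0 < v x + eta)%R by rewrite ltr_wpDl.
    have := powR_tangent n_gt1 Z0 w0 (rho0 x).
    by rewrite -/q -aE -bE /h mulrA.
rewrite ge0_integralD//; last 4 first.
- by move=> x _; rewrite -EFinD -EFinM lee_fin mulr_ge0// addr_ge0// ltW.
- apply: measurable_funTS; apply: measurable_funeM; exact: emeasurable_funD.
- by move=> x _; rewrite !mule_ge0 ?lee_fin.
- apply: measurable_funTS; apply: measurable_funeM.
  by apply: emeasurable_funM => //; exact: hE.
rewrite EFinD; apply: leeD.
  rewrite ge0_integralZl//; last 2 first.
  - by apply: measurable_funTS; exact: emeasurable_funD.
  - by move=> x _; rewrite -EFinD lee_fin addr_ge0// ltW.
  rewrite EFinM lee_wpmul2l ?lee_fin// ge0_integralD//; last 3 first.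
  - by move=> x _; rewrite lee_fin.
  - exact: measurable_funTS.
  - by move=> x _; rewrite lee_fin ltW.
  rewrite EFinD integral_cst// EFinM fineK; last exact: ball_measure_fin_num.
  rewrite leeD2r// -VE; apply: ge0_subset_integral => // x _.
  by rewrite lee_fin.
rewrite ge0_integralZl//; last 2 first.
- by apply: measurable_funTS; apply: emeasurable_funM => //; exact: hE.
- by move=> x _; rewrite -EFinM lee_fin mulr_ge0.
rewrite EFinM lee_wpmul2l ?lee_fin//; apply: le_trans hrho.
apply: ge0_subset_integral => //.
- by apply: emeasurable_funM => //; exact: hE.
- by move=> x _; rewrite -EFinM lee_fin mulr_ge0.
Qed.

Lemma entropy_bound : \int[m]_x (ac_density m mut x `^ q)%:E <=
  (n^-1 * Z `^ (- q) * V + q * Z `^ (- q) * U)%:E.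
Proof.
apply/lee_addgt0Pr => e e0.
pose c := (n^-1 * Z `^ (- q) * fine (m K))%R.
have c0 : (0 <= c)%R by rewrite !mulr_ge0 ?powR_ge0 ?fine_ge0// invr_ge0 ltW.
have c1 : (0 < c + 1)%R by rewrite ltr_wpDl.
apply: le_trans (@entropy_eta (e / (c + 1))%R _) _; first by rewrite divr_gt0.
rewrite -EFinD lee_fin.
have : (e / (c + 1) * c <= e)%R.
  rewrite mulrAC ler_pdivrMr//; nra.
by rewrite /c; set w := (e / _)%R; nra.
Qed.

End entropy_bound.

Let integral_uniform_density_powR r : (0 < r)%R ->
  \int[m]_x (uniform_density m (ball x0 r) x `^ q)%:E =
  (fine (m (ball x0 r)) `^ n^-1)%:E.
Proof.
move=> r0'; set B : set (borel X) := ball x0 r.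
have mB : measurable B by exact: ball_borel.
have mBfin : m B \is a fin_num by exact: ball_measure_fin_num.
have b0 : (0 < fine (m B))%R.
  by rewrite fine_gt0// ball_measure_gt0//= ltey_eq mBfin.
have qE x : (uniform_density m B x `^ q =
    fine (m B) `^ (- q) * \1_B x)%R.
  rewrite /uniform_density indicE; case: (x \in B) => /=.
    by rewrite mul1r mulr1 -powR_inv1 ?(ltW b0)// -powRrM mulN1r.
  by rewrite mul0r mulr0 powR0// gt_eqF.
under eq_integral do rewrite qE EFinM.
rewrite ge0_integralZl//; last first.
  by apply/measurable_EFinP; exact: measurable_indic.
rewrite integral_indic// setIT -[X in _ * X]fineK// -EFinM; congr (_%:E).
rewrite -[X in (_ * X)%R]powRr1 ?(ltW b0)// -powRD.
  by rewrite /q opprB subrK.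
by rewrite (gt_eqF b0) implybT.
Qed.

(** After multiplication by Z^q the entropy inequality reads (1 - t) U + t m(B_r)^(1/n) Z^q <= V/n +
    (1 - 1/n) U; subtracting (1 - t) U leaves (V - U)/n + t U on the right. *)
Lemma transport_sobolev r : (0 < r)%R -> (0 < eps < r0 + r + 1)%R ->
  (eps / (r0 + r + 1) * (fine (m (ball x0 r)) `^ n^-1 * Z `^ q) <=
   n^-1 * (V - U) + eps / (r0 + r + 1) * U)%R.
Proof.
move=> r_gt0 /andP[eps0 epsD]; have [_ sepX _ _] := mmsX.
have D0 : (0 < r0 + r + 1)%R by exact: lt_trans epsD.
have [t tE] : exists t, t = (eps / (r0 + r + 1))%R by eexists.
rewrite -tE.
have t0 : (0 < t)%R by rewrite tE divr_gt0.
have t01 : (0 < t < 1)%R by rewrite t0 tE ltr_pdivrMr// mul1r.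
have mB s : measurable (ball x0 s : set (borel X)) by exact: ball_borel.
have mBfin : m (ball x0 r) \is a fin_num by exact: ball_measure_fin_num.
have [|mu_ [geo mu0 mu1 ent]] := CD0_densities CDX mf0 f00 If0
  (measurable_uniform_density m (mB r)) (uniform_density_ge0 m (ball x0 r))
  (integralT_uniform_density (mB r) (ball_measure_gt0 mmsX x0 r_gt0) mBfin)
  (ex_intro _ x0 (ex_intro _ r0 f0_supp)).
  exists x0, r => z /=; rewrite /uniform_density indicE.
  by have [/set_mem//|_] := boolP (z \in _); rewrite mul0r eqxx.
have near delta : (0 < delta)%R ->
    exists2 g : {finite_measure set (borel X * borel X)%type -> \bar R},
      coupling (mu_ 0%R) (mu_ t) g &
      g [set p | (eps <= mdist (p.1 : X) (p.2 : X))%R] <= delta%:E.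
  move=> delta0.
  have N0 : mu_ 0%R (~` ball x0 r0) = 0.
    rewrite mu0; last exact: measurableC.
    apply: integral0_eq => x nx.
    by have [->//|/eqP/f0_supp/nx] := pselect (f0 x = 0%R).
  have N1 : mu_ 1%R (~` ball x0 r) = 0.
    rewrite mu1; last exact: measurableC.
    rewrite integral_uniform_density//; last exact: measurableC.
    by rewrite setICr measure0 mule0.
  (* The distance between the supports is at most [r0 + r]. With the excess [s := t] the threshold
     is [t * (r0 + r) + t], which is exactly [eps]; this is where the 1 in the denominator of [t]
     comes from. *)
  have [|g [_ [gc _ g1 _]]] :=
      displacement (L := (r0 + r)%R) sepX geo (mB r0) (mB r) N0 N1 _ t01 t0 delta0.
    move=> x y /ball_mdist xx0 /ball_mdist yx0.
    have := metric_triangle x x0 y; rewrite (metric_sym x x0); lra.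
  exists g => //; move: g1; congr (g _ <= _); apply/seteqP.
  by split=> z /=; rewrite (_ : t * _ + t = eps)%R// tE; field; rewrite gt_eqF.
have tI : (0 <= t <= 1)%R by have /andP[_ t1] := t01; rewrite !ltW.
have := ent t tI; rewrite /renyi_entropy leeN2 -/q => ent'.
have {ent'} := le_trans ent' (entropy_bound mu0 near).
rewrite integral_uniform_density_powR// If0q -!EFinM -EFinD lee_fin => h.
have Zq0 : (0 < Z `^ q)%R by rewrite powR_gt0.
have ZZ : (Z `^ (- q) * Z `^ q = 1)%R.
  by rewrite powRN mulVf// gt_eqF.
move: h; rewrite -(ler_pM2r Zq0).
set b := (fine _ `^ _)%R.
rewrite (_ : ((1 - t) * (Z `^ (- q) * U) + t * b) * Z `^ q =
  (1 - t) * U * (Z `^ (- q) * Z `^ q) + t * (b * Z `^ q))%R; last by ring.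
rewrite (_ : (n^-1 * Z `^ (- q) * V + q * Z `^ (- q) * U) * Z `^ q =
  (n^-1 * V + q * U) * (Z `^ (- q) * Z `^ q))%R; last by ring.
rewrite ZZ !mulr1 /q; set W := (t * _)%R; lra.
Qed.

End transport_sobolev.

(** * Slopes of locally Lipschitz functions *)

Section slope.
Context {R : realType} {X : completeMetricType R}.
Implicit Types (u : X -> R) (x y : X).

(* The point [y = x] contributes [0 / 0 = 0] to the supremum. *)
Definition diff_quotient u (e : R) x : \bar R :=
  ereal_sup [set (`|u y - u x| / mdist x y)%:E | y in [set y | (mdist x y < e)%R]].

Lemma diff_quotient_ge0 u e x : (0 < e)%R -> 0 <= diff_quotient u e x.
Proof.
move=> e0; apply: ereal_sup_ubound; exists x; first by rewrite /= mdistxx.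
by rewrite subrr normr0 mul0r.
Qed.

Lemma le_diff_quotient u e e' x : (e <= e')%R ->
  diff_quotient u e x <= diff_quotient u e' x.
Proof.
move=> ee'; apply: ereal_sup_le => _ [y xy <-]; exists y => //=.
exact: lt_le_trans xy ee'.
Qed.

Lemma diff_quotient_le u e (a : R) x : (0 <= a)%R ->
  (forall y, (mdist x y < e)%R -> (`|u y - u x| <= a * mdist x y)%R) ->
  diff_quotient u e x <= a%:E.
Proof.
move=> a0 ua; apply: ge_ereal_sup => _ [y xy <-]; rewrite lee_fin.
have [->|yx] := eqVneq y x; first by rewrite subrr normr0 mul0r.
by rewrite ler_pdivrMr ?mdist_gt0 1?eq_sym//; exact: ua.
Qed.

Lemma diff_quotient_ub u e x y : (mdist x y < e)%R ->
  (`|u y - u x|)%:E <= (mdist x y)%:E * diff_quotient u e x.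
Proof.
move=> xy; have [->|yx] := eqVneq y x.
  by rewrite subrr normr0 mdistxx mul0e.
have d0 : (0 < mdist x y)%R by rewrite mdist_gt0 eq_sym.
have -> : `|u y - u x|%R = (mdist x y * (`|u y - u x| / mdist x y))%R.
  by rewrite mulrCA mulfV ?mulr1// gt_eqF.
rewrite EFinM lee_wpmul2l//; first by rewrite lee_fin ltW.
by apply: ereal_sup_ubound; exists y.
Qed.

(** One formula covers both cases. At an isolated point small balls contain only [x], with quotient
    0; elsewhere the added value 0 at [y = x] does not raise the supremum, since other points
    contribute nonnegative quotients. *)
Lemma slopeE u x :
  slope u x = ereal_inf [set diff_quotient u e x | e in [set e | (0 < e)%R]].
Proof.
rewrite /slope; case: ifPn => [/asboolP[_ [V xV VE]]|/asboolPn niso].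
  have /nbhs_ballP[e /= e0 eV] := xV.
  apply/eqP; rewrite eq_le; apply/andP; split.
    by apply: le_ereal_inf_tmp => _ [e' e'0 <-]; exact: diff_quotient_ge0.
  apply: ge_ereal_inf; exists (diff_quotient u e x); first by exists e.
  apply: diff_quotient_le => // y /ball_mdist/eV Vy.
  have : (V `&` [set: X]) y by [].
  by rewrite VE => ->; rewrite subrr normr0 mul0r.
apply/eqP; rewrite eq_le; apply/andP; split.
  apply: le_ereal_inf_tmp => _ [e /= e0 <-].
  apply: ge_ereal_inf.
  exists (ereal_sup ((fun y => (`|u y - u x| / mdist x y)%:E) @`
      [set y | (mdist x y < e)%R /\ y != x])).
    exists [set y | (mdist x y < e)%R /\ y != x] => //.
    apply/nbhs_ballP; exists e => // y /ball_mdist xy yx.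
    by split.
  by apply: ereal_sup_le => _ [y [xy _] <-]; exists y.
apply: le_ereal_inf_tmp => _ [V xV <-].
have /nbhs_ballP[e /= e0 eV] : nbhs x [set y | y != x -> V y] by exact: xV.
apply: ge_ereal_inf; exists (diff_quotient u e x); first by exists e.
have [y xy yx] : exists2 y, (mdist x y < e)%R & y != x.
  apply: contrapT => h; apply: niso; split; first by rewrite inE.
  exists (ball x e); first exact: nbhsx_ballx.
  apply/seteqP; split=> [y [/ball_mdist xy _]|_ ->].
    by apply/eqP/negPn/negP => yx; apply: h; exists y.
  by split => //; apply/ball_mdist; rewrite mdistxx.
apply: ge_ereal_sup => _ [z xz <-]; have [->|zx] := eqVneq z x; last first.
  by apply: ereal_sup_ubound; exists z => //; apply: eV => //; apply/ball_mdist.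
rewrite subrr normr0 mul0r.
apply: (@le_trans _ _ (`|u y - u x| / mdist x y)%:E).
  by rewrite lee_fin divr_ge0// mdist_ge0.
by apply: ereal_sup_ubound; exists y => //; apply: eV => //; apply/ball_mdist.
Qed.

Lemma slope_ge0 u x : 0 <= slope u x.
Proof.
by rewrite slopeE; apply: le_ereal_inf_tmp => _ [e e0 <-]; exact: diff_quotient_ge0.
Qed.

Lemma cvg_diff_quotient u x :
  diff_quotient u (k.+1%:R^-1)%R x @[k --> \oo] --> slope u x.
Proof.
have : nonincreasing_seq (fun k => diff_quotient u (k.+1%:R^-1)%R x).
  move=> k l kl; apply: le_diff_quotient.
  by rewrite lef_pV2 ?posrE ?ltr0n// ler_nat.
move/ereal_nonincreasing_cvgn; congr (_ --> _).
rewrite slopeE; apply/eqP; rewrite eq_le; apply/andP; split.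
  apply: le_ereal_inf_tmp => _ [e /= e0 <-].
  apply: ge_ereal_inf; exists (diff_quotient u ((Num.truncn e^-1).+1%:R^-1)%R x).
    by exists (Num.truncn e^-1).
  apply: le_diff_quotient; rewrite -[leRHS]invrK lef_pV2 ?posrE ?invr_gt0//.
  by apply/ltW; rewrite truncnS_gt.
apply: ereal_inf_le_tmp => _ [k _ <-].
by exists (k.+1%:R^-1)%R => //=.
Qed.

(** The function is lower semicontinuous: a point [y] whose quotient at [x] exceeds [a] is still a
    witness at all nearby [z]. *)
Lemma measurable_diff_quotient u e : continuous u -> (0 < e)%R ->
  measurable_fun [set: borel X] (diff_quotient u e).
Proof.
move=> /continuous_mdist cu e0; apply: lsce_borel => a.
have [a0|a0] := ltP a 0%R.
  rewrite (_ : [set x | _] = setT); first exact: openT.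
  apply/seteqP; split=> // x _ /=; apply: lt_le_trans (diff_quotient_ge0 _ _ e0).
  by rewrite lte_fin.
apply/open_mdistP => x /= /ereal_sup_gt[_ [y /= xy <-]]; rewrite lte_fin => ax.
have yx : y != x.
  by apply: contraTneq ax => ->; rewrite subrr normr0 mul0r -leNgt.
have d0 : (0 < mdist x y)%R by rewrite mdist_gt0 eq_sym.
move: ax; rewrite ltr_pdivlMr// => gap.
pose g := ((`|u y - u x| - a * mdist x y) / 2)%R.
have g0 : (0 < g)%R by rewrite /g divr_gt0// subr_gt0.
have [d d0' du] := cu x g g0.
(* In this order the bounds keep the change of [u] below [g], keep [y] within [e] of [z], keep [z]
   away from [y], and keep [a * mdist x z] at most [g]. The two losses are covered by the gap
   [2 * g]. *)
pose r := Num.min (Num.min d (e - mdist x y)%R)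
  (Num.min (mdist x y) (g / (a + 1))%R).
have a1 : (0 < a + 1)%R by rewrite ltr_wpDl.
exists r; first by rewrite /r !lt_min d0' subr_gt0 xy d0 divr_gt0.
move=> z; rewrite /r !lt_min => /andP[/andP[xzd xze] /andP[xzy xzg]].
have := metric_triangle z x y; rewrite (metric_sym z x) => zxy.
have := metric_triangle x z y => xzy'.
have zy0 : (0 < mdist z y)%R by lra.
apply: (@lt_le_trans _ _ (`|u y - u z| / mdist z y)%:E); last first.
  by apply: ereal_sup_ubound; exists y => //=; lra.
rewrite lte_fin ltr_pdivlMr//.
have uzx := du _ xzd.
have uyz : (`|u y - u x| <= `|u y - u z| + `|u z - u x|)%R.
  by rewrite (le_trans _ (ler_normD _ _))// addrA subrK.
have xzg' : (a * mdist x z <= g)%R.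
  have : (a * mdist x z <= a * (g / (a + 1)))%R by rewrite ler_wpM2l// ltW.
  move/le_trans; apply; rewrite mulrA ler_pdivrMr//; nra.
have azy : (a * mdist z y <= a * (mdist x z + mdist x y))%R by rewrite ler_wpM2l.
have gE : (2 * g = `|u y - u x| - a * mdist x y)%R.
  by rewrite /g mulrC divfK.
by lra.
Qed.

Lemma measurable_slope u : continuous u -> measurable_fun [set: borel X] (slope u).
Proof.
move=> cu; apply: (emeasurable_fun_cvg
  (fun k => diff_quotient u (k.+1%:R^-1)%R : borel X -> \bar R)).
- by move=> k; apply: measurable_diff_quotient => //; rewrite invr_gt0.
- by move=> x _; exact: cvg_diff_quotient.
Qed.

End slope.

Section locally_lipschitz.
Context {R : realType} {X : completeMetricType R}.
Implicit Types (u : X -> R).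

Lemma locally_lipschitz_ball u x : locally_lipschitz u ->
  exists2 r, (0 < r)%R & exists2 L, (0 <= L)%R & forall y z : X,
    (mdist x y < r)%R -> (mdist x z < r)%R -> (`|u y - u z| <= L * mdist y z)%R.
Proof.
move=> /(_ x)[U /nbhs_ballP[r /= r0 rU] [L uL]]; exists r => //.
exists (Num.max 0%R L); first by rewrite le_max lexx.
move=> y z /ball_mdist xy /ball_mdist xz.
apply: le_trans (uL y z (rU _ xy) (rU _ xz)) _.
by rewrite ler_wpM2r ?mdist_ge0// le_max lexx orbT.
Qed.

Lemma locally_lipschitz_continuous u : locally_lipschitz u -> continuous u.
Proof.
move=> lu; apply/continuous_mdist => x e e0.
have [r r0 [L L0 uL]] := locally_lipschitz_ball x lu.
have L1 : (0 < L + 1)%R by rewrite ltr_wpDl.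
exists (Num.min r (e / (L + 1))%R); first by rewrite lt_min r0 divr_gt0.
move=> y; rewrite lt_min => /andP[xyr xye].
apply: le_lt_trans (uL y x xyr _) _; first by rewrite mdistxx.
rewrite metric_sym; apply: (@le_lt_trans _ _ ((L + 1) * mdist x y)%R).
  by rewrite ler_wpM2r ?mdist_ge0// lerDl.
by rewrite mulrC -ltr_pdivlMr.
Qed.

(** A single index [N] serves both as Lipschitz constant and, through 1/(N + 1), as radius, so that
    compactness in its near-covering form gives both uniformly. *)
Lemma locally_lipschitz_compact u (K : set X) : locally_lipschitz u -> compact K ->
  exists2 d, (0 < d)%R & exists2 L, (0 <= L)%R & forall x y : X, K x ->
    (mdist x y < d)%R -> (`|u y - u x| <= L * mdist x y)%R.
Proof.
move=> lu /compact_near_coveringP.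
move=> /(_ nat \oo (fun N x => forall y, (mdist x y < N.+1%:R^-1)%R ->
  (`|u y - u x| <= N%:R * mdist x y)%R)) /(_ _)[|N _ /(_ N) /= h].
  move=> x _; have [r r0 [L L0 uL]] := locally_lipschitz_ball x lu.
  (* Beyond [L + 2 / r], the index exceeds the local constant [L], and the radius 1/(N + 1) is at
     most [r / 2]. *)
  exists (ball x (r / 2)%R, [set N | (Num.truncn (L + 2 / r)%R < N)%N]).
    split; first by apply: nbhsx_ballx; rewrite divr_gt0.
    by exists (Num.truncn (L + 2 / r)%R).+1.
  move=> [z N] /= [/ball_mdist xz LN] y zy.
  have LN' : (L + 2 / r <= N%:R)%R.
    by apply/ltW; rewrite (lt_le_trans (truncnS_gt _))// ler_nat.
  have r2 : (0 <= 2 / r)%R by rewrite divr_ge0// ltW.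
  have Nr : (N.+1%:R^-1 <= r / 2)%R.
    rewrite -[leRHS]invrK lef_pV2 ?posrE ?invr_gt0 ?divr_gt0//.
    rewrite invf_div (le_trans _ (_ : N%:R <= _)%R) ?ler_nat//; lra.
  have xz' : (mdist x z < r)%R by lra.
  have xy' : (mdist x y < r)%R by have := metric_triangle x z y; have := lt_le_trans zy Nr; lra.
  apply: le_trans (uL y z xy' xz') _; rewrite metric_sym.
  by rewrite ler_wpM2r ?mdist_ge0//; lra.
exists (N.+1%:R^-1)%R; first by rewrite invr_gt0.
by exists N%:R => // x y Kx xy; exact: h.
Qed.

Lemma continuous_compact_bounded u (K : set X) : continuous u -> compact K ->
  exists2 M, (0 <= M)%R & forall x : X, K x -> (`|u x| <= M)%R.
Proof.
move=> /continuous_mdist cu /compact_near_coveringP.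
move=> /(_ nat \oo (fun N x => (`|u x| <= N%:R)%R)) /(_ _)[|N _ /(_ N) /= h].
  move=> x _; have [d d0 xd] := cu x 1%R ltr01.
  exists (ball x d, [set N | (Num.truncn (`|u x| + 1)%R < N)%N]).
    split; first exact: nbhsx_ballx.
    by exists (Num.truncn (`|u x| + 1)%R).+1.
  move=> [z N] /= [/ball_mdist/xd xz LN].
  have LN' : (`|u x| + 1 <= N%:R)%R.
    by apply/ltW; rewrite (lt_le_trans (truncnS_gt _))// ler_nat.
  have : (`|u z| <= `|u z - u x| + `|u x|)%R.
    by rewrite (le_trans _ (ler_normD _ _))// subrK.
  lra.
by exists N%:R => // x Kx; exact: h.
Qed.

End locally_lipschitz.

(** * Sobolev inequality *)

Section bounded_support.
Context {R : realType} {X : completeMetricType R}.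
Variable m : {measure set (borel X) -> \bar R}.
Hypothesis mmsX : metric_measure_space m.
Variable n : R.
Hypothesis n_gt1 : (1 < n)%R.
Hypothesis CDX : CD0 m n.
Variables (x0 : X) (c r1 : R).
Hypothesis c0 : (0 < c)%R.
Hypothesis growth : forall r, (r1 <= r)%R -> (c * r `^ n)%:E <= m (ball x0 r).

Let n0 : (0 < n)%R. Proof. exact: lt_trans n_gt1. Qed.

Lemma integral_bounded_support (w : borel X -> R) M r :
  measurable_fun setT w -> (forall x, (0 <= w x <= M)%R) ->
  (forall x : X, w x != 0%R -> ball x0 r x) ->
  \int[m]_x (w x)%:E \is a fin_num.
Proof.
move=> mw wM wsupp.
have M0 : (0 <= M)%R by have /andP[a b] := wM point; exact: le_trans b.
rewrite ge0_fin_numE; last first.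
  by apply: integral_ge0 => x _; rewrite lee_fin; have /andP[] := wM x.
have mB : measurable (ball x0 r : set (borel X)) by exact: ball_borel.
apply: (@le_lt_trans _ _ (\int[m]_x (M%:E * (\1_(ball x0 r : set (borel X)) x)%:E))).
  apply: ge0_le_integral => //.
  - by move=> x _; rewrite lee_fin; have /andP[] := wM x.
  - exact/measurable_EFinP.
  - by apply: measurable_funeM; apply/measurable_EFinP; exact: measurable_indic.
  - move=> x _; rewrite -EFinM lee_fin indicE.
    have [->|wx] := eqVneq (w x) 0%R; first by rewrite mulr_ge0.
    by rewrite mem_set ?mulr1; [have /andP[] := wM x|exact: wsupp].
rewrite ge0_integralZl//; last by apply/measurable_EFinP; exact: measurable_indic.
rewrite integral_indic// setIT lte_mul_pinfty//.
by rewrite -ge0_fin_numE//; exact: ball_measure_fin_num.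
Qed.

(** Multiplied by [r0 + r + 1], the transport inequality bounds a linear function of [r] by a
    constant for all large [r], so the coefficient of [r] cannot be positive. This is the passage r
    -> oo. *)
Lemma sobolev_eps (r0 eps : R) (u v : borel X -> R) (U V Z : R) :
  (0 < r0)%R -> (0 < eps)%R ->
  measurable_fun setT u -> (forall x, (0 <= u x)%R) ->
  (forall x : X, u x != 0%R -> ball x0 r0 x) ->
  measurable_fun setT v -> (forall x, (0 <= v x)%R) ->
  (forall x z : X, (mdist x z < eps)%R -> (u x <= v z)%R) ->
  \int[m]_x (u x)%:E = U%:E -> \int[m]_x (v x)%:E = V%:E ->
  \int[m]_x (u x `^ (n / (n - 1)))%:E = Z%:E -> (0 < Z)%R ->
  (n * c `^ n^-1 * Z `^ (1 - n^-1) * eps <= V - U)%R.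
Proof.
move=> r0_gt0 eps0 mu u0 usupp mv v0 uv UE VE ZE Z0.
pose A := (c `^ n^-1 * Z `^ (1 - n^-1))%R.
have main r : (0 < r)%R -> (r1 <= r)%R -> (eps < r)%R ->
    (r * (eps * A - n^-1 * (V - U)) <=
     n^-1 * (V - U) * (r0 + 1) + eps * U)%R.
  move=> r_gt0 rr1 epsr.
  have D0 : (0 < r0 + r + 1)%R by lra.
  have epsD : (0 < eps < r0 + r + 1)%R by rewrite eps0; lra.
  have := transport_sobolev mmsX n_gt1 CDX mu u0 usupp mv v0 uv UE VE ZE Z0 r_gt0 epsD.
  have : (c `^ n^-1 * r <= fine (m (ball x0 r)) `^ n^-1)%R.
    have : (c * r `^ n <= fine (m (ball x0 r)))%R.
      by rewrite -lee_fin fineK; [exact: growth|exact: ball_measure_fin_num].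
    move=> h; rewrite (_ : c `^ n^-1 * r = (c * r `^ n) `^ n^-1)%R; last first.
      rewrite powRM ?powR_ge0 ?(ltW c0)//.
      by rewrite -powRrM mulfV ?gt_eqF// powRr1// ltW.
    have fb0 : (0 <= fine (m (ball x0 r)))%R by exact: fine_ge0.
    have cr0 : (0 <= c * r `^ n)%R by rewrite mulr_ge0 ?powR_ge0// ltW.
    by apply: ge0_ler_powR h; rewrite ?nnegrE// invr_ge0 ltW.
  set b := (fine _ `^ _)%R => cb /(ler_wpM2r (ltW D0)); rewrite mulrDl.
  have cancel (a y e : R) : (e != 0 -> a / e * y * e = a * y)%R.
    by move=> e0; field.
  rewrite !cancel ?gt_eqF//.
  have : (eps * (A * r) <= eps * (b * Z `^ (1 - n^-1)))%R.
    rewrite ler_wpM2l ?(ltW eps0)// /A mulrAC ler_wpM2r ?powR_ge0//.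
  move=> h1 h2; have {h1 h2} := le_trans h1 h2.
  by set W := (n^-1 * (V - U))%R; lra.
suff : (eps * A <= n^-1 * (V - U))%R.
  rewrite -(ler_pM2l n0) [leRHS]mulrA mulfV ?gt_eqF// mul1r; apply: le_trans.
  by rewrite /A le_eqVlt; apply/orP; left; apply/eqP; ring.
rewrite leNgt; apply/negP; rewrite -subr_gt0 => gap.
set g := (eps * A - _)%R in gap main.
pose C := (n^-1 * (V - U) * (r0 + 1) + eps * U)%R.
(* The first summands meet the lower bounds on [r]; the last one makes [r * g] exceed [C]. *)
pose r := (`|r1| + eps + 1 + `|C| / g)%R.
have Cg : (0 <= `|C| / g)%R by rewrite divr_ge0// ltW.
have r1r : (r1 <= r)%R by rewrite /r; have := ler_norm r1; lra.
have r1_0 : (0 <= `|r1|)%R by [].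
have := main r _ r1r _; rewrite -/C => /(_ _ _)/wrap[||].
- by rewrite /r; lra.
- by rewrite /r; lra.
rewrite /r mulrDl divfK ?gt_eqF//.
have := ler_norm C; have : (0 < (`|r1| + eps + 1) * g)%R by rewrite mulr_gt0//; lra.
lra.
Qed.

Lemma sobolev_bounded_support (u : X -> R) (r0 : R) : (0 < r0)%R ->
  locally_lipschitz u -> (forall x, (0 <= u x)%R) ->
  (forall x : X, u x != 0%R -> ball x0 r0 x) ->
  (n * c `^ n^-1)%:E *
    (\int[m]_(x in [set: borel X]) (u x `^ (n / (n - 1)))%:E) `^ ((n - 1) / n)
  <= slope_energy m u.
Proof.
move=> r0_gt0 lu u0 usupp.
have cu := locally_lipschitz_continuous lu.
have mu : measurable_fun [set: borel X] u by exact: continuous_borel.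
pose K := mclosed_ball x0 (r0 + 1)%R.
have cK : compact K by exact: compact_mclosed_ball_CD0 CDX x0 _.
have mK : measurable (K : set (borel X)).
  by apply: closed_borel; exact: closed_mclosed_ball.
have [M M0 uM] := continuous_compact_bounded cu cK.
have {}uM x : (0 <= u x <= M)%R.
  rewrite u0/=; have [->//|/usupp/ball_mdist x0x] := eqVneq (u x) 0%R.
  by apply: le_trans (ler_norm _) (uM x _); rewrite /K/mclosed_ball/=; lra.
have slope0 : 0 <= slope_energy m u by apply: integral_ge0 => x _; exact: slope_ge0.
have p0 : (n / (n - 1) != 0)%R by rewrite gt_eqF// divr_gt0// subr_gt0.
have mup : measurable_fun [set: borel X] (fun x => u x `^ (n / (n - 1)))%R.
  exact: measurableT_comp (measurable_powR _) mu.
have p_ge0 : (0 <= n / (n - 1))%R by rewrite divr_ge0 ?ltW// subr_gt0.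
have Zfin : \int[m]_(x in [set: borel X]) (u x `^ (n / (n - 1)))%:E \is a fin_num.
  apply: (@integral_bounded_support _ (M `^ (n / (n - 1)))%R r0) => // x.
    rewrite powR_ge0/=; have /andP[_ uxM] := uM x.
    by apply: ge0_ler_powR => //; rewrite nnegrE.
  by move=> ux; apply: usupp; apply: contra_neq ux => ->; rewrite powR0.
have [Z ZE] : exists Z, \int[m]_(x in [set: borel X]) (u x `^ (n / (n - 1)))%:E = Z%:E.
  by eexists; rewrite -[LHS]fineK.
have Z_ge0 : (0 <= Z)%R.
  by rewrite -lee_fin -ZE; apply: integral_ge0 => x _; rewrite lee_fin powR_ge0.
have qE : ((n - 1) / n = 1 - n^-1)%R by field; rewrite gt_eqF.
have q0 : (0 < 1 - n^-1)%R by rewrite subr_gt0 invf_lt1.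
rewrite ZE qE poweR_EFin -EFinM.
have [Z0|Z0] := eqVneq Z 0%R.
  by rewrite Z0 powR0 ?gt_eqF// mulr0.
have {Z_ge0}Z0 : (0 < Z)%R by rewrite lt_neqAle eq_sym Z0.
have Ufin : \int[m]_(x in [set: borel X]) (u x)%:E \is a fin_num.
  exact: (@integral_bounded_support _ M r0).
have [U UE] : exists U, \int[m]_(x in [set: borel X]) (u x)%:E = U%:E.
  by eexists; rewrite -[LHS]fineK.
have [d d0 [L L0 uL]] := locally_lipschitz_compact lu cK.
have step eps : (0 < eps)%R ->
    (n * c `^ n^-1 * Z `^ (1 - n^-1))%:E <=
    \int[m]_(x in [set: borel X]) diff_quotient u eps x.
  move=> eps0.
  (* As a supremum over open balls [v] is lower semicontinuous, hence measurable. It exceeds [u] by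
     at most [eps] times the difference quotient. *)
  pose v (z : borel X) : R := sup [set u x | x in [set x | (mdist x z < eps)%R]].
  have vsup z : has_sup [set u x | x in [set x | (mdist x z < eps)%R]].
    split; first by exists (u z); exists z => //=; rewrite mdistxx.
    by exists M => _ [x _ <-]; have /andP[] := uM x.
  have uv (x z : X) : (mdist x z < eps)%R -> (u x <= v z)%R.
    by move=> xz; apply: (sup_upper_bound (vsup z)); exists x.
  have v0 z : (0 <= v z)%R.
    by apply: le_trans (u0 z) _; apply: uv; rewrite mdistxx.
  have mv : measurable_fun [set: borel X] v.
    apply: lsc_borel => a; apply/open_mdistP => z /=.
    move=> /(sup_gt (vsup z).1)[_ [x xz <-] ax].
    exists (eps - mdist x z)%R; first by rewrite subr_gt0.
    move=> z' zz'; apply: lt_le_trans ax _; apply: uv.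
    by have := metric_triangle x z z'; lra.
  have vM z : (0 <= v z <= M)%R.
    rewrite v0/=; apply: ge_sup; first exact: (vsup z).1.
    by move=> _ [x _ <-]; have /andP[] := uM x.
  have vsupp (z : X) : v z != 0%R -> ball x0 (r0 + eps)%R z.
    move=> vz; have : (0 < v z)%R by rewrite lt_neqAle eq_sym vz v0.
    move=> /(sup_gt (vsup z).1)[_ [x /= xz <-] ux].
    have /ball_mdist x0x : ball x0 r0 x by apply: usupp; rewrite gt_eqF.
    by apply/ball_mdist; have := metric_triangle x0 x z; lra.
  have Vfin : \int[m]_(x in [set: borel X]) (v x)%:E \is a fin_num.
    exact: (@integral_bounded_support _ M (r0 + eps)%R).
  have [V VE] : exists V, \int[m]_(x in [set: borel X]) (v x)%:E = V%:E.
    by eexists; rewrite -[LHS]fineK.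
  have := sobolev_eps r0_gt0 eps0 mu u0 usupp mv v0 uv UE VE ZE Z0.
  have mdq := measurable_diff_quotient cu eps0.
  have dq0 x : 0 <= diff_quotient u eps x by exact: diff_quotient_ge0.
  have : V%:E <= U%:E + eps%:E * \int[m]_(x in [set: borel X]) diff_quotient u eps x.
    rewrite -VE -UE -ge0_integralZl//; last by rewrite lee_fin ltW.
    rewrite -ge0_integralD//; last 4 first.
    - by move=> x _; rewrite lee_fin.
    - exact/measurable_EFinP.
    - by move=> x _; rewrite mule_ge0// lee_fin ltW.
    - exact: measurable_funeM.
    apply: ge0_le_integral => //.
    - by move=> x _; rewrite lee_fin.
    - exact/measurable_EFinP.
    - by apply: emeasurable_funD; [exact/measurable_EFinP|exact: measurable_funeM].
    move=> z _; case E : (diff_quotient u eps z) (dq0 z) => [s||]// s0; last first.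
      by rewrite gt0_muley ?lte_fin// addey// leey.
    rewrite -EFinM -EFinD lee_fin; apply: ge_sup; first exact: (vsup z).1.
    move=> _ [x /= xz <-]; rewrite metric_sym in xz.
    have := diff_quotient_ub u xz; rewrite E -EFinM lee_fin => h.
    have : (mdist z x * s <= eps * s)%R by rewrite ler_wpM2r// ltW.
    by have := ler_norm (u x - u z); lra.
  have : 0 <= \int[m]_(x in [set: borel X]) diff_quotient u eps x.
    exact: integral_ge0.
  case: (\int[m]_(x in [set: borel X]) diff_quotient u eps x) => [s||]// s0;
    last by rewrite leey.
  rewrite -EFinM -EFinD !lee_fin => h1 h2.
  rewrite -(ler_pM2r eps0); lra.
(* The sequence of radii starts below [d], where the uniform Lipschitz bound on [K] holds, and below
   1, so that balls centred outside [K] miss the support of [u]. Hence [g], supported in [K],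
   dominates. *)
pose k0 := Num.truncn (Num.min d 1)^-1%R.
have k0E k : ((k + k0).+1%:R^-1 < Num.min d 1)%R.
  have md : (0 < Num.min d 1)%R by rewrite lt_min d0 ltr01.
  rewrite -[ltRHS]invrK ltf_pV2 ?posrE ?invr_gt0//.
  by rewrite (lt_le_trans (truncnS_gt _))// ler_nat ltnS leq_addl.
pose f_ k := diff_quotient u ((k + k0).+1%:R^-1)%R : borel X -> \bar R.
have e0 k : (0 < (k + k0).+1%:R^-1 :> R)%R by rewrite invr_gt0.
have f0 k x : 0 <= f_ k x by exact: diff_quotient_ge0.
pose g (x : borel X) := L%:E * (\1_(K : set (borel X)) x)%:E.
have mg : measurable_fun [set: borel X] g.
  by apply: measurable_funeM; apply/measurable_EFinP; exact: measurable_indic.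
have ig : m.-integrable [set: borel X] g.
  apply/integrableP; split=> //.
  under eq_integral do rewrite gee0_abs ?mule_ge0 ?lee_fin//.
  rewrite ge0_integralZl//; last by apply/measurable_EFinP; exact: measurable_indic.
  rewrite integral_indic// setIT lte_mul_pinfty//.
  rewrite (@le_lt_trans _ _ (m (ball x0 (r0 + 2))))//.
    rewrite le_measure ?inE//; first exact: ball_borel.
    by move=> x Kx; apply/ball_mdist; move: Kx; rewrite /K/mclosed_ball/=; lra.
  by rewrite -ge0_fin_numE//; exact: ball_measure_fin_num.
have fg k x : `|f_ k x| <= g x.
  rewrite gee0_abs// /f_ /g -EFinM indicE.
  have := k0E k; rewrite lt_min => /andP[kd k1].
  have [/set_mem Kx|/negP nKx] := boolP (x \in (K : set (borel X))).
    rewrite mulr1; apply: diff_quotient_le => // y xy; apply: uL => //.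
    exact: lt_trans kd.
  rewrite mulr0; apply: diff_quotient_le => // y xy.
  have x0x : (r0 + 1 < mdist x0 x)%R.
    by rewrite ltNge; apply/negP => h; apply: nKx; rewrite inE.
  have ux : u x = 0%R.
    by apply/eqP/negPn/negP => /usupp/ball_mdist; lra.
  have uy : u y = 0%R.
    apply/eqP/negPn/negP => /usupp/ball_mdist.
    have := metric_triangle x0 y x; rewrite (metric_sym y x).
    by have := lt_trans xy k1; lra.
  by rewrite ux uy subrr normr0 mul0r.
have fs x : f_ k x @[k --> \oo] --> slope u x.
  have := @cvg_diff_quotient _ _ u x.
  by rewrite -(cvg_shiftn k0 (fun k => diff_quotient u (k.+1%:R^-1)%R x)).
have [_ _ fcvg] := @dominated_convergence _ _ _ m _ measurableT f_ (slope u) g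
  (fun k => measurable_diff_quotient cu (e0 k)) (measurable_slope cu)
  (aeW _ (fun x _ => fs x)) ig
  (aeW _ (fun x k _ => fg k x)).
rewrite /slope_energy -(cvg_lim _ fcvg)//.
apply: lime_ge; first by apply/cvg_ex; eexists; exact: fcvg.
by apply: nearW => k; exact: step.
Qed.

End bounded_support.

Lemma limn_einf_lt (R : realType) (u : (\bar R)^nat) (a : \bar R) N :
  limn_einf u < a -> exists2 i, (N <= i)%N & u i < a.
Proof.
move=> ua; apply: contrapT => h; move: ua; apply/negP; rewrite -leNgt.
rewrite limn_einf_lim; apply: lime_ge; first exact: is_cvg_einfs.
exists N => // m /= Nm; apply: le_ereal_inf_tmp => _ [i /= mi <-].
rewrite leNgt; apply/negP => uia; apply: h; exists i => //.
exact: leq_trans mi.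
Qed.

(** Tangent line of the convex power at the truncated value, where p - 1 = 1/(n - 1). Truncation at
    [M] bounds the slope, so that closeness in L^1 controls integrals of p-th powers. *)
Lemma powR_truncation (R : realType) (n a b M : R) :
  (1 < n -> 0 <= a -> 0 <= b -> 0 <= M ->
  Num.min a M `^ (n / (n - 1)) <= b `^ (n / (n - 1)) +
    n / (n - 1) * M `^ (n - 1)^-1 * `|b - a|)%R.
Proof.
move=> n1 a0 b0 M0; set p := (n / (n - 1))%R; set a' : R := Num.min a M.
have nm1 : (0 < n - 1)%R by rewrite subr_gt0.
have n0 : (0 < n)%R by exact: lt_trans n1.
have p0 : (0 < p)%R by rewrite divr_gt0.
have k0 : (0 <= (n - 1)^-1)%R by rewrite invr_ge0 ltW.
have a'0 : (0 <= a')%R by rewrite /a' le_min a0.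
have [a'b|ba'] := leP a' b.
  rewrite (le_trans (ge0_ler_powR (ltW p0) _ _ a'b)) ?nnegrE// lerDl.
  by rewrite !mulr_ge0 ?powR_ge0// ltW.
have pE : (p = 1 + (n - 1)^-1)%R by rewrite /p; field; rewrite gt_eqF.
(* Young's inequality for the conjugate exponents [p] and [n], which amounts to the tangent line
   inequality at [a']. *)
have young : (b * a' `^ (n - 1)^-1 <= b `^ p / p + a' `^ p / n)%R.
  have := @conjugate_powR R b (a' `^ (n - 1)^-1)%R p n b0 (powR_ge0 _ _) p0 n0.
  rewrite -powRrM (_ : ((n - 1)^-1 * n = p)%R); last by rewrite mulrC.
  by apply; rewrite /p; field; rewrite !gt_eqF.
have a'p : (a' `^ p = a' * a' `^ (n - 1)^-1)%R.
  rewrite pE powRD ?powRr1//; apply/implyP => /eqP.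
  by have := k0; lra.
have pn : (p / n = p - 1)%R by rewrite /p; field; rewrite !gt_eqF.
have tangent : (a' `^ p <= b `^ p + p * a' `^ (n - 1)^-1 * (a' - b))%R.
  have split (B A : R) : (p * (B / p + A / n) = B + (p - 1) * A)%R.
    rewrite -pn mulrDr mulrCA mulfV ?gt_eqF// mulr1; congr (_ + _)%R; ring.
  move: young; rewrite -(ler_pM2l p0) split.
  move=> h; have : (p * a' `^ (n - 1)^-1 * (a' - b) =
    p * a' `^ p - p * (b * a' `^ (n - 1)^-1))%R by rewrite a'p; ring.
  by move=> ->; lra.
apply: le_trans tangent _; rewrite lerD2l.
apply: ler_pM.
- by rewrite mulr_ge0 ?powR_ge0// ltW.
- by rewrite subr_ge0 ltW.
- rewrite ler_wpM2l ?(ltW p0)// ge0_ler_powR ?nnegrE//.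
  by rewrite /a' ge_min lexx orbT.
- have : (a' <= a)%R by rewrite /a' ge_min lexx.
  by have := ler_norm (a - b); rewrite distrC; lra.
Qed.

(** * Removal of the support condition by cutting off *)

Section cutoff.
Context {R : realType} {X : completeMetricType R}.
Variable m : {measure set (borel X) -> \bar R}.
Hypothesis mmsX : metric_measure_space m.
Variable n : R.
Hypothesis n_gt1 : (1 < n)%R.
Hypothesis CDX : CD0 m n.
Variables (x0 : X) (c r1 : R).
Hypothesis c0 : (0 < c)%R.
Hypothesis growth : forall r, (r1 <= r)%R -> (c * r `^ n)%:E <= m (ball x0 r).

Definition cutoff (rho : R) (x : X) : R :=
  Num.max 0%R (Num.min 1%R (2 - mdist x0 x / rho)%R).

Lemma cutoff_itv rho x : (0 <= cutoff rho x <= 1)%R.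
Proof. by rewrite /cutoff le_max lexx/= ge_max ler01 ge_min lexx. Qed.

Lemma cutoff_lipschitz rho x y : (0 < rho)%R ->
  (`|cutoff rho y - cutoff rho x| <= rho^-1 * mdist x y)%R.
Proof.
move=> rho0.
have h : (`|mdist x0 y / rho - mdist x0 x / rho| <= rho^-1 * mdist x y)%R.
  rewrite -mulrBl normrM [X in (_ * X)%R]gtr0_norm ?invr_gt0// mulrC.
  rewrite ler_pM2l ?invr_gt0//; have := mdist_le_dist y x x0.
  by rewrite (metric_sym y x0) (metric_sym x x0) (metric_sym y x).
pose f (s : R) : R := Num.max 0%R (Num.min 1%R (2 - s)%R).
have half (s t d : R) : (0 <= d -> t - s <= d -> f s - f t <= d)%R.
  move=> d0 tsd; rewrite lerBlDr /f ge_max addr_ge0 ?le_max ?lexx//=.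
  have [t1|t1] := leP 1%R (2 - t)%R.
    apply: (@le_trans _ _ 1%R); first by rewrite ge_min lexx.
    by rewrite (max_r ler01) lerDr.
  apply: (@le_trans _ _ (2 - s)%R); first by rewrite ge_min lexx orbT.
  apply: (@le_trans _ _ (d + (2 - t))%R); first lra.
  by rewrite lerD2l le_max lexx orbT.
have d0 : (0 <= rho^-1 * mdist x y)%R by rewrite mulr_ge0 ?mdist_ge0// invr_ge0 ltW.
have := half (mdist x0 y / rho)%R (mdist x0 x / rho)%R _ d0.
have := half (mdist x0 x / rho)%R (mdist x0 y / rho)%R _ d0.
rewrite /f.
move: h; rewrite ler_norml => /andP[h1 h2] H1 H2.
rewrite ler_norml /cutoff; apply/andP; split.
  by rewrite -lerN2 opprK opprB; apply: H1; lra.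
by apply: H2; lra.
Qed.

Lemma cutoff1 rho x : (0 < rho)%R -> (mdist x0 x < rho)%R -> cutoff rho x = 1%R.
Proof.
move=> rho0 xr; have : (mdist x0 x / rho <= 1)%R.
  by rewrite ler_pdivrMr// mul1r ltW.
by move=> h; rewrite /cutoff min_l ?max_r//; lra.
Qed.

Lemma cutoff0 rho x : (0 < rho)%R -> (2 * rho <= mdist x0 x)%R ->
  cutoff rho x = 0%R.
Proof.
move=> rho0 xr; have : (2 <= mdist x0 x / rho)%R by rewrite ler_pdivlMr.
by move=> h; rewrite /cutoff max_l// ge_min; apply/orP; right; lra.
Qed.

Lemma cutoff_diff (rho : R) (v : X -> R) (x y : X) : (0 < rho)%R ->
  (`|cutoff rho y * `|v y| - cutoff rho x * `|v x| | <=
   `|v y - v x| + `|v x| / rho * mdist x y)%R.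
Proof.
move=> rho0.
have -> : (cutoff rho y * `|v y| - cutoff rho x * `|v x| =
  cutoff rho y * (`|v y| - `|v x|) + `|v x| * (cutoff rho y - cutoff rho x))%R.
  by ring.
apply: le_trans (ler_normD _ _) _; rewrite !normrM normr_id.
have /andP[e0 e1] := cutoff_itv rho y.
apply: lerD.
  rewrite (ger0_norm e0); apply: le_trans (ler_piMl _ e1) _ => //.
  exact: ler_dist_dist.
by rewrite -mulrA ler_wpM2l// cutoff_lipschitz.
Qed.

Lemma locally_lipschitz_cutoff (rho : R) (v : X -> R) : (0 < rho)%R -> locally_lipschitz v ->
  locally_lipschitz (fun x => cutoff rho x * `|v x|)%R.
Proof.
move=> rho0 lv x; have [r r0 [L L0 vL]] := locally_lipschitz_ball x lv.
exists (ball x r); first exact: nbhsx_ballx.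
exists (L + (`|v x| + L * r) / rho)%R => y z /ball_mdist xy /ball_mdist xz.
apply: le_trans (cutoff_diff v _ _ rho0) _.
rewrite (metric_sym z y) mulrDl; apply: lerD; first exact: vL.
rewrite ler_wpM2r ?mdist_ge0// ler_pM2r ?invr_gt0//.
have := vL z x xz _; rewrite mdistxx => /(_ r0); rewrite metric_sym => vzx.
have : (L * mdist x z <= L * r)%R by rewrite ler_wpM2l// ltW.
have : (`|v z| <= `|v z - v x| + `|v x|)%R.
  by rewrite (le_trans _ (ler_normD _ _))// subrK.
lra.
Qed.

(** Leibniz rule for difference quotients at a fixed scale, then the infimum over scales. The extra
    term lives on a closed ball because outside it the cutoff vanishes on a whole neighbourhood. *)
Lemma slope_cutoff (rho : R) (v : X -> R) (x : X) : (0 < rho)%R ->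
  slope (fun x => cutoff rho x * `|v x|)%R x <=
  slope v x + (rho^-1)%:E *
    (`|v x| * \1_(mclosed_ball x0 (2 * rho)%R) x)%:E.
Proof.
move=> rho0; set u := (fun x => _).
have le_dq e : (0 < e)%R -> slope u x <= diff_quotient u e x.
  by move=> e0; rewrite slopeE; apply: ereal_inf_lbound; exists e.
have [/set_mem xb|/negP nxb] :=
    boolP (x \in (mclosed_ball x0 (2 * rho)%R : set X)); last first.
  apply: (@le_trans _ _ 0); last first.
    by rewrite adde_ge0 ?slope_ge0// mule_ge0 ?lee_fin ?invr_ge0 ?mulr_ge0// ltW.
  have far : (2 * rho < mdist x0 x)%R.
    by rewrite ltNge; apply/negP => h; apply: nxb; rewrite inE.
  apply: le_trans (le_dq (mdist x0 x - 2 * rho)%R _) _; first by rewrite subr_gt0.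
  apply: diff_quotient_le => // y xy; rewrite /u !cutoff0 ?(ltW far)//.
    by rewrite !mul0r subrr normr0.
  have := metric_triangle x0 y x; rewrite (metric_sym y x); lra.
rewrite indicE mem_set// mulr1 -EFinM -leeBlDr// [leRHS]slopeE.
apply: le_ereal_inf_tmp => _ [e e0 <-]; rewrite leeBlDr//.
apply: le_trans (le_dq e e0) _; apply: ge_ereal_sup => _ [y /= xy <-].
apply: (@le_trans _ _ ((`|v y - v x| / mdist x y)%:E + (rho^-1 * `|v x|)%:E)).
  rewrite -EFinD lee_fin; have [->|yx] := eqVneq y x.
    rewrite !subrr normr0 !mul0r add0r mulr_ge0// invr_ge0 ltW//.
  have d0 : (0 < mdist x y)%R by rewrite mdist_gt0 eq_sym.
  rewrite ler_pdivrMr// mulrDl divfK ?gt_eqF//.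
  by apply: le_trans (cutoff_diff v x y rho0) _; rewrite (mulrC _ rho^-1%R).
rewrite leeD2r//; apply: ereal_sup_ubound; by exists y.
Qed.

(** The price of the cutoff is an L^1 norm divided by [rho], which is negligible for large [rho]
    along functions close to an integrable one. *)
Lemma sobolev_cutoff (rho : R) (v : X -> R) : (0 < rho)%R -> locally_lipschitz v ->
  (n * c `^ n^-1)%:E *
    (\int[m]_(x in (ball x0 rho : set (borel X)))
      (`|v x| `^ (n / (n - 1)))%:E) `^ ((n - 1) / n)
  <= slope_energy m v +
     (rho^-1)%:E * \int[m]_(x in (mclosed_ball x0 (2 * rho)%R : set (borel X)))
       `|v x|%:E.
Proof.
move=> rho0 lv; set u := (fun x => cutoff rho x * `|v x|)%R.
have n0 : (0 < n)%R by exact: lt_trans n_gt1.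
have nm1 : (0 < n - 1)%R by rewrite subr_gt0.
have cv := locally_lipschitz_continuous lv.
have mv : measurable_fun [set: borel X] v by exact: continuous_borel.
have lu : locally_lipschitz u by exact: locally_lipschitz_cutoff.
have cu := locally_lipschitz_continuous lu.
have mu : measurable_fun [set: borel X] u by exact: continuous_borel.
have u0 x : (0 <= u x)%R by rewrite mulr_ge0//; have /andP[] := cutoff_itv rho x.
have usupp (x : X) : u x != 0%R -> ball x0 (2 * rho)%R x.
  move=> ux; apply/ball_mdist; rewrite ltNge; apply: contra_neqN ux => h.
  by rewrite /u cutoff0// mul0r.
have r2 : (0 < 2 * rho)%R by rewrite mulr_gt0.
have mB : measurable (ball x0 rho : set (borel X)) by exact: ball_borel.
have mK : measurable (mclosed_ball x0 (2 * rho)%R : set (borel X)).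
  by apply: closed_borel; exact: closed_mclosed_ball.
have mnv : measurable_fun [set: borel X] (fun x => `|v x|)%R.
  exact: measurableT_comp.
have main := sobolev_bounded_support mmsX n_gt1 CDX c0 growth r2 lu u0 usupp.
apply: le_trans _ (le_trans main _).
  rewrite lee_wpmul2l//; first by rewrite lee_fin mulr_ge0 ?powR_ge0// ltW.
  have p0 : (0 <= n / (n - 1))%R by rewrite divr_ge0 ?ltW.
  have I0 (D : set (borel X)) (w : X -> R) : 0 <= \int[m]_(x in D) (w x `^ (n / (n - 1)))%:E.
    by apply: integral_ge0 => x _; rewrite lee_fin powR_ge0.
  apply: gt0_ler_poweR.
  - by rewrite divr_ge0 ?ltW.
  - by rewrite in_itv/= I0 leey.
  - by rewrite in_itv/= I0 leey.
  apply: (@le_trans _ _ (\int[m]_(x in (ball x0 rho : set (borel X)))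
      (u x `^ (n / (n - 1)))%:E)).
    rewrite le_eqVlt; apply/orP; left; apply/eqP; apply: eq_integral => x.
    by move=> /set_mem /ball_mdist xr; rewrite /u cutoff1// mul1r.
  apply: ge0_subset_integral => //.
  - by apply/measurable_EFinP; exact: measurableT_comp (measurable_powR _) mu.
  - by move=> x _; rewrite lee_fin powR_ge0.
have mI : measurable_fun [set: borel X] (fun x =>
    (`|v x| * \1_(mclosed_ball x0 (2 * rho)%R : set (borel X)) x)%:E).
  by apply/measurable_EFinP; apply: measurable_funM => //; exact: measurable_indic.
have -> : \int[m]_(x in (mclosed_ball x0 (2 * rho)%R : set (borel X))) `|v x|%:E =
    \int[m]_(x in [set: borel X])
      (`|v x| * \1_(mclosed_ball x0 (2 * rho)%R : set (borel X)) x)%:E.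
  by rewrite integral_mkcond epatch_indic.
have ri0 : (0 <= rho^-1)%R by rewrite invr_ge0 ltW.
have msv := measurable_slope cv.
rewrite -ge0_integralZl//.
rewrite /slope_energy -ge0_integralD//; last 3 first.
- by move=> x _; exact: slope_ge0.
- by move=> x _; rewrite mule_ge0// lee_fin mulr_ge0.
- exact: measurable_funeM.
apply: ge0_le_integral => //.
- by move=> x _; exact: slope_ge0.
- exact: measurable_slope.
- by apply: emeasurable_funD => //; exact: measurable_funeM.
- by move=> x _; exact: slope_cutoff.
Qed.

End cutoff.

(** * Lower semicontinuity under local convergence in L^1 *)

Section lower_semicontinuity.
Context {R : realType} {X : completeMetricType R}.
Variable m : {measure set (borel X) -> \bar R}.
Hypothesis mmsX : metric_measure_space m.
Variable n : R.
Hypothesis n_gt1 : (1 < n)%R.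
Hypothesis CDX : CD0 m n.
Variables (x0 : X) (c r1 : R).
Hypothesis c0 : (0 < c)%R.
Hypothesis growth : forall r, (r1 <= r)%R -> (c * r `^ n)%:E <= m (ball x0 r).

Let p : R := (n / (n - 1))%R.
Let q : R := ((n - 1) / n)%R.
Let A : R := (n * c `^ n^-1)%R.

Let nm1 : (0 < n - 1)%R. Proof. by rewrite subr_gt0. Qed.
Let n0 : (0 < n)%R. Proof. exact: lt_trans n_gt1. Qed.
Let p0 : (0 < p)%R. Proof. by rewrite divr_gt0. Qed.
Let q0 : (0 < q)%R. Proof. by rewrite divr_gt0. Qed.
Let pq : (q * p = 1)%R. Proof. by rewrite /p /q; field; rewrite !gt_eqF. Qed.
Let A0 : (0 < A)%R. Proof. by rewrite mulr_gt0// powR_gt0. Qed.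

(** The root is inverted in extended reals; the finite bound excludes [I = +oo]. *)
Let poweR_le (I : \bar R) (B : R) : 0 <= I -> (0 <= B)%R ->
  A%:E * I `^ q <= B%:E -> I <= ((B / A) `^ p)%:E.
Proof.
move=> I0 B0.
case: I I0 => [i||]// i0.
  rewrite poweR_EFin -EFinM !lee_fin mulrC -ler_pdivlMr// => h.
  rewrite lee_fin in i0.
  rewrite -[leLHS]powRr1// -pq powRrM; apply: ge0_ler_powR => //.
  - exact: ltW.
  - by rewrite nnegrE powR_ge0.
  - by rewrite nnegrE divr_ge0// ltW.
by rewrite poweRyr ?gt_eqF// gt0_muley ?lte_fin// leye_eq.
Qed.

Let le_poweR (I : \bar R) (B : R) : 0 <= I -> (0 <= B)%R ->
  I <= ((B / A) `^ p)%:E -> A%:E * I `^ q <= B%:E.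
Proof.
move=> I0 B0 IB.
have BA0 : (0 <= B / A)%R by rewrite divr_ge0// ltW.
have : I `^ q <= (((B / A) `^ p)%:E) `^ q.
  by apply: gt0_ler_poweR IB; rewrite ?(ltW q0)//= in_itv/= ?I0 ?leey// lee_fin powR_ge0.
rewrite poweR_EFin -powRrM (mulrC p) pq powRr1// => h.
apply: (@le_trans _ _ (A%:E * (B / A)%:E)).
  by rewrite lee_wpmul2l// lee_fin ltW.
by rewrite -EFinM lee_fin mulrC divfK// gt_eqF.
Qed.

(** Convergence in L^1 on balls says nothing directly about p-th powers. The truncations [h k], cut
    at height and radius [k.+1], are controlled by [powR_truncation] with a bound independent of
    [k], and they increase to the p-th power of [f]; no almost everywhere convergent subsequence is
    extracted. *)
Lemma sobolev_lsc (f : X -> R) (f_ : (X -> R)^nat) : L1 m f ->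
  (forall i, locally_lipschitz (f_ i)) ->
  (forall rho, (0 < rho)%R ->
    \int[m]_(x in (mclosed_ball x0 rho : set (borel X))) `|f_ i x - f x|%:E
      @[i --> \oo] --> 0) ->
  A%:E * (\int[m]_(x in [set: borel X]) (`|f x| `^ p)%:E) `^ q <=
  limn_einf (fun i => slope_energy m (f_ i)).
Proof.
move=> f1 lf f_f.
have mf : measurable_fun [set: borel X] f by apply/measurable_EFinP; exact: measurable_int f1.
have mnf : measurable_fun [set: borel X] (fun x => `|f x|)%R by exact: measurableT_comp.
have mf_ i : measurable_fun [set: borel X] (f_ i).
  exact: continuous_borel (locally_lipschitz_continuous (lf i)).
have mnf_ i : measurable_fun [set: borel X] (fun x => `|f_ i x|)%R.
  exact: measurableT_comp.
have mpow (w : borel X -> R) r : measurable_fun setT w ->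
    measurable_fun setT (fun x => (w x `^ r)%:E).
  by move=> mw; apply/measurable_EFinP; exact: measurableT_comp (measurable_powR _) mw.
set J := limn_einf _.
have J0 : 0 <= J.
  rewrite /J limn_einf_lim; apply: lime_ge; first exact: is_cvg_einfs.
  apply: nearW => i; apply: le_ereal_inf_tmp => _ [k _ <-].
  by apply: integral_ge0 => x _; exact: slope_ge0.
case JE : J J0 => [j||]// j0; last by rewrite leey.
apply/lee_addgt0Pr => e e0; rewrite -EFinD.
rewrite lee_fin in j0.
have je0 : (0 <= j + e)%R by rewrite addr_ge0// ltW.
apply: le_poweR => //.
  by apply: integral_ge0 => x _; rewrite lee_fin powR_ge0.
have [C CE] : exists C, \int[m]_(x in [set: borel X]) `|f x|%:E = C%:E.
  have /integrableP[_ foo] := f1.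
  by eexists; rewrite -[LHS]fineK// ge0_fin_numE//; exact: integral_ge0.
have C0 : (0 <= C)%R by rewrite -lee_fin -CE; exact: integral_ge0.
pose B (k : nat) : set (borel X) := ball x0 k.+1%:R.
have mB k : measurable (B k) by exact: ball_borel.
pose h (k : nat) (x : borel X) : R :=
  (\1_(B k) x * Num.min `|f x| k.+1%:R `^ p)%R.
have mtr k : measurable_fun [set: borel X] (fun x => Num.min `|f x| k.+1%:R)%R.
  exact: measurable_minr.
have mh k : measurable_fun [set: borel X] (fun x => (h k x)%:E).
  apply/measurable_EFinP; apply: measurable_funM; first exact: measurable_indic.
  by apply/measurable_EFinP; exact: mpow.
have h0 k x : (0 <= h k x)%R by rewrite mulr_ge0 ?powR_ge0.
have min0 (x : X) k : (0 <= Num.min `|f x| k.+1%:R)%R by rewrite le_min normr_ge0/=.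
have hbound k : \int[m]_(x in [set: borel X]) (h k x)%:E <= (((j + e) / A) `^ p)%:E.
  pose M : R := k.+1%:R.
  (* The summand [M] makes the ball contain [B k]; the other makes the cutoff error, at most
     [(C + 1) / rho], no larger than [e / 2]. *)
  pose rho : R := (M + 2 * (C + 1) / e)%R.
  have Ce : (0 <= 2 * (C + 1) / e)%R by rewrite divr_ge0 ?(ltW e0)// mulr_ge0// addr_ge0.
  have M0 : (0 < M)%R by rewrite /M ltr0n.
  have rho0 : (0 < rho)%R by rewrite /rho ltr_wpDr.
  have rhoe : (rho^-1 * (C + 1) <= e / 2)%R.
    rewrite mulrC ler_pdivrMr//.
    apply: (@le_trans _ _ (e / 2 * (2 * (C + 1) / e))%R).
      rewrite (_ : e / 2 * (2 * (C + 1) / e) = C + 1)%R//.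
      by field; rewrite gt_eqF.
    by rewrite ler_wpM2l ?divr_ge0 ?(ltW e0)// /rho lerDr ltW.
  pose K : set (borel X) := mclosed_ball x0 (2 * rho)%R.
  have mK : measurable K by apply: closed_borel; exact: closed_mclosed_ball.
  have BK : B k `<=` K.
    move=> x /ball_mdist xM; rewrite /K /mclosed_ball /=.
    rewrite -/M in xM; rewrite /rho; lra.
  have BB : B k `<=` (ball x0 rho : set (borel X)).
    by move=> x /ball_mdist xM; apply/ball_mdist; rewrite -/M in xM; rewrite /rho; lra.
  apply/lee_addgt0Pr => d d0.
  pose D : R := (p * M `^ (n - 1)^-1)%R.
  have D0 : (0 <= D)%R by rewrite mulr_ge0 ?powR_ge0// ltW.
  (* The bound 1 keeps the L^1 norm of [f_ i] on [K] below [C + 1]; the bound [d / (D + 1)] keeps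
     the truncation error [D * delta] below [d]. *)
  pose delta : R := Num.min 1%R (d / (D + 1))%R.
  have D1 : (0 < D + 1)%R by rewrite ltr_wpDl.
  have delta0 : (0 < delta)%R by rewrite lt_min ltr01 divr_gt0.
  have r2 : (0 < 2 * rho)%R by rewrite mulr_gt0.
  have [N _ Nd] : \forall i \near \oo,
      \int[m]_(x in K) `|f_ i x - f x|%:E < delta%:E.
    apply: (f_f _ r2 [set y | y < delta%:E]); apply: open_nbhs_nbhs.
    by split; [exact: open_ereal_lt_ereal|rewrite /= lte_fin].
  have [|i Ni ie] := @limn_einf_lt _ (fun i => slope_energy m (f_ i)) (j + e / 2)%:E N.
    by rewrite -/J JE lte_fin ltrDl divr_gt0.
  have {Nd}Nd := Nd i Ni.
  have mdiff : measurable_fun [set: borel X] (fun x => `|f_ i x - f x|%:E).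
    apply/measurable_EFinP; apply: measurableT_comp => //.
    exact: measurable_funB.
  have fiC : \int[m]_(x in K) `|f_ i x|%:E <= (C + 1)%:E.
    apply: (@le_trans _ _ (\int[m]_(x in K) (`|f x|%:E + `|f_ i x - f x|%:E))).
      apply: ge0_le_integral => //.
      - exact/measurable_funTS/measurable_EFinP.
      - by apply: measurable_funTS; apply: emeasurable_funD => //; exact/measurable_EFinP.
      - move=> x _; rewrite -EFinD lee_fin.
        by rewrite (le_trans _ (ler_normD _ _))// addrC subrK.
    rewrite ge0_integralD//; last 2 first.
    - exact/measurable_funTS/measurable_EFinP.
    - exact: measurable_funTS.
    rewrite EFinD; apply: leeD.
      by rewrite -CE; apply: ge0_subset_integral => //; exact/measurable_EFinP.
    by apply: le_trans (ltW Nd) _; rewrite lee_fin /delta ge_min lexx.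
  have cut := sobolev_cutoff mmsX n_gt1 CDX c0 growth rho0 (lf i).
  have fp : \int[m]_(x in (ball x0 rho : set (borel X))) (`|f_ i x| `^ p)%:E <=
      (((j + e) / A) `^ p)%:E.
    apply: poweR_le => //.
      by apply: integral_ge0 => x _; rewrite lee_fin powR_ge0.
    apply: le_trans cut _.
    apply: (@le_trans _ _ ((j + e / 2)%:E + (rho^-1 * (C + 1))%:E)).
      apply: leeD; first exact: ltW.
      by rewrite EFinM lee_wpmul2l// lee_fin invr_ge0 ltW.
    by rewrite -EFinD lee_fin; lra.
  apply: (@le_trans _ _ (\int[m]_(x in B k)
      ((`|f_ i x| `^ p)%:E + D%:E * `|f_ i x - f x|%:E))).
    have -> : \int[m]_(x in [set: borel X]) (h k x)%:E =
        \int[m]_(x in B k) (Num.min `|f x| k.+1%:R `^ p)%:E.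
      rewrite [RHS]integral_mkcond epatch_indic; apply: eq_integral => x _.
      by rewrite /h mulrC EFinM.
    apply: ge0_le_integral => //.
    - by apply: measurable_funTS; exact: mpow.
    - apply: measurable_funTS; apply: emeasurable_funD; first exact: mpow.
      exact: measurable_funeM.
    - move=> x _; rewrite -EFinM -EFinD lee_fin.
      have := powR_truncation n_gt1 (normr_ge0 (f x)) (normr_ge0 (f_ i x)) (ltW M0).
      move/le_trans; apply; rewrite lerD2l ler_wpM2l//.
      exact: ler_dist_dist.
  rewrite ge0_integralD//; last 3 first.
  - by apply: measurable_funTS; exact: mpow.
  - by move=> x _; rewrite -EFinM lee_fin mulr_ge0.
  - by apply: measurable_funTS; exact: measurable_funeM.
  apply: leeD.
    apply: le_trans fp; apply: ge0_subset_integral => //.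
    - exact: ball_borel.
    - by apply: measurable_funTS; exact: mpow.
  rewrite ge0_integralZl//; last exact: measurable_funTS.
  apply: (@le_trans _ _ (D%:E * delta%:E)).
    rewrite lee_wpmul2l//.
    apply: le_trans (ltW Nd); apply: ge0_subset_integral => //.
    exact: measurable_funTS.
  rewrite -EFinM lee_fin; apply: (@le_trans _ _ (D * (d / (D + 1)))%R).
    by rewrite ler_wpM2l// /delta ge_min lexx orbT.
  by rewrite mulrA ler_pdivrMr//; nra.
have ndh x : nondecreasing_seq (fun k => (h k x)%:E).
  move=> k l kl; rewrite lee_fin /h; apply: ler_pM => //.
    rewrite !indicE; case: (boolP (x \in B k)) => [/set_mem/ball_mdist xk|_].
      rewrite mem_set//; apply/ball_mdist; apply: lt_le_trans xk _.
      by rewrite ler_nat.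
    by rewrite ler0n.
  apply: ge0_ler_powR; rewrite ?(ltW p0) ?nnegrE//.
  by rewrite le_min !ge_min lexx/= ler_nat ltnS kl orbT.
have hcvg x : (h k x)%:E @[k --> \oo] --> (`|f x| `^ p)%:E.
  apply: cvg_near_cst.
  exists (maxn (Num.truncn `|f x|) (Num.truncn (mdist x0 x))) => // k /=.
  rewrite geq_max => /andP[k1 k2]; rewrite /h indicE mem_set; last first.
    by apply/ball_mdist; rewrite (lt_le_trans (truncnS_gt _))// ler_nat.
  by rewrite mul1r min_l// ltW// (lt_le_trans (truncnS_gt _))// ler_nat.
have -> : \int[m]_(x in [set: borel X]) (`|f x| `^ p)%:E =
    \int[m]_(x in [set: borel X]) limn (fun k => (h k x)%:E).
  by apply: eq_integral => x _; apply/esym/cvg_lim.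
rewrite (@monotone_convergence _ _ _ m _ measurableT (fun k x => (h k x)%:E))//.
  apply: lime_le; last by apply: nearW.
  apply: ereal_nondecreasing_is_cvgn => k l kl; apply: ge0_le_integral => //.
    by move=> x _; rewrite lee_fin.
  by move=> x _; exact: ndh.
by move=> k x _; rewrite lee_fin.
Qed.

End lower_semicontinuity.

(** * Asymptotic volume ratio *)

(** This is the limit as [t] increases to [L], done in extended reals: [L] and [y] may be [+oo], and
    0 * +oo = 0 settles the degenerate cases. *)
Lemma lt_real_mule_le (R : realType) (L y W : \bar R) : 0 <= L -> 0 <= y -> 0 <= W ->
  (forall t : R, (0 < t)%R -> t%:E < L -> t%:E * y <= W) -> L * y <= W.
Proof.
move=> L0 y0 W0 LyW.
have [->|Lneq0] := eqVneq L 0; first by rewrite mul0e.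
have {Lneq0}L0 : 0 < L by rewrite lt_def Lneq0.
have [->|yneq0] := eqVneq y 0; first by rewrite mule0.
have {yneq0}y0 : 0 < y by rewrite lt_def yneq0.
have between (s : R) : (0 <= s)%R -> s%:E < L -> exists2 t : R, (s < t)%R & t%:E < L.
  case: L {L0 LyW} => [l||]// s0 sl.
    by exists ((s + l) / 2)%R; rewrite ?lte_fin in sl *; lra.
  by exists (s + 1)%R; rewrite ?ltrDl// ltry.
case: W W0 LyW => [w||] W0 LyW //; last by rewrite leey.
case: y y0 LyW => [y||] y0 LyW //; last first.
  have [t t0 tL] := between 0%R (lexx _) L0.
  by have := LyW t t0 tL; rewrite gt0_muley ?lte_fin// leye_eq.
rewrite lte_fin in y0; rewrite lee_fin in W0.
rewrite -lee_pdivlMr//; rewrite leNgt; apply/negP => wL.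
have wy : (0 <= w / y)%R by rewrite divr_ge0// ltW.
have [t wt tL] := between _ wy wL.
have := LyW t (le_lt_trans wy wt) tL.
by rewrite -EFinM lee_fin -ler_pdivlMr// leNgt wt.
Qed.

Lemma Gamma_ge0 (R : realType) (z : R) : (0 <= Gamma z)%R.
Proof. by apply: Rintegral_ge0 => t _; rewrite mulr_ge0 ?powR_ge0 ?expR_ge0. Qed.

Lemma omega_ge0 (R : realType) (n : R) : (0 <= omega n)%R.
Proof. by rewrite divr_ge0 ?powR_ge0 ?Gamma_ge0. Qed.

Lemma slope_energy_ge0 (R : realType) (X : completeMetricType R)
  (m : {measure set (borel X) -> \bar R}) (u : X -> R) : 0 <= slope_energy m u.
Proof. by apply: integral_ge0 => x _; exact: slope_ge0. Qed.

Lemma limn_einf_ge0 (R : realType) (u : (\bar R)^nat) :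
  (forall i, 0 <= u i) -> 0 <= limn_einf u.
Proof.
move=> u0; rewrite limn_einf_lim; apply: lime_ge; first exact: is_cvg_einfs.
by apply: nearW => i; apply: le_ereal_inf_tmp => _ [k _ <-].
Qed.

Section avr.
Context {R : realType} {X : completeMetricType R}.
Variable m : {measure set (borel X) -> \bar R}.
Hypothesis mmsX : metric_measure_space m.
Variable n : R.
Hypothesis n_gt1 : (1 < n)%R.
Hypothesis CDX : CD0 m n.
Variable x0 : X.

Let n0 : (0 < n)%R. Proof. exact: lt_trans n_gt1. Qed.
Let F (r : R) : \bar R := m (ball x0 r) * ((omega n * r `^ n)^-1)%:E.

Let F_ge0 r : 0 <= F r.
Proof. by rewrite mule_ge0// lee_fin invr_ge0 mulr_ge0 ?omega_ge0 ?powR_ge0. Qed.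

(** [lim] of a divergent family is the default point of the extended reals, which is 0. A positive
    ratio therefore forces convergence. *)
Lemma AVR_cvgPn : ~ cvg (F r @[r --> +oo%R]) -> AVR m n x0 = 0.
Proof. by move=> Fn; rewrite /AVR dvgP. Qed.

Lemma AVR_ge0 : 0 <= AVR m n x0.
Proof.
have [cF|/AVR_cvgPn->//] := pselect (cvg (F r @[r --> +oo%R])).
by apply: lime_ge => //; exact: nearW.
Qed.

Lemma AVR_growth (c : R) : (0 < omega n)%R -> (0 < c)%R -> c%:E < AVR m n x0 ->
  exists r1, forall r, (r1 <= r)%R -> (c * omega n * r `^ n)%:E <= m (ball x0 r).
Proof.
move=> w0 c0 cA.
have cF : cvg (F r @[r --> +oo%R]).
  by apply/not_notP => /AVR_cvgPn AE; move: cA; rewrite AE lte_fin ltNge (ltW c0).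
have : \forall r \near +oo%R, c%:E < F r.
  apply: (cF [set y | c%:E < y]); apply: open_nbhs_nbhs.
  by split; [exact: open_ereal_gt_ereal|exact: cA].
move=> [r1 [_ r1F]].
(* The maximum and the added 1 make [r] positive and strictly larger than [r1], as the
   neighbourhoods of infinity require. *)
exists (Num.max r1 0 + 1)%R => r rr.
have [r1r r0] : (r1 < r)%R /\ (0 < r)%R.
  by split; apply: lt_le_trans rr; rewrite ltr_pwDr// le_max lexx ?orbT.
have d0 : (0 < omega n * r `^ n)%R by rewrite mulr_gt0// powR_gt0.
have := ltW (r1F r r1r); rewrite /F lee_pdivlMr//.
by rewrite -EFinM mulrA.
Qed.

(** For each t below AVR^(1/n) the balls grow at least like c r^n with c = t^n omega_n, and c^(1/n)
    = t omega_n^(1/n) is the constant sought with t in place of AVR^(1/n). *)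
Lemma sobolev_AVR (f : X -> R) (f_ : (X -> R)^nat) : L1 m f ->
  (forall i, locally_lipschitz (f_ i)) ->
  (forall rho, (0 < rho)%R ->
    \int[m]_(x in (mclosed_ball x0 rho : set (borel X))) `|f_ i x - f x|%:E
      @[i --> \oo] --> 0) ->
  (n * omega n `^ n^-1)%:E * AVR m n x0 `^ n^-1 *
    (\int[m]_(x in [set: borel X]) (`|f x| `^ (n / (n - 1)))%:E) `^ ((n - 1) / n) <=
  limn_einf (fun i => slope_energy m (f_ i)).
Proof.
move=> f1 lf f_f.
set I := \int[m]_x _; set q := ((n - 1) / n)%R; set W := limn_einf _.
have W0 : 0 <= W by apply: limn_einf_ge0 => i; exact: slope_energy_ge0.
have ni0 : (0 < n^-1)%R by rewrite invr_gt0.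
(* If [omega n] is 0 the left-hand side is 0, so [omega n] may be taken positive. *)
have := omega_ge0 n; rewrite le_eqVlt => /predU1P[<-|w0].
  by rewrite powR0 ?gt_eqF// mulr0 !mul0e.
rewrite (muleC (n * _)%:E) -muleA; apply: lt_real_mule_le => //.
- exact: poweR_ge0.
- by rewrite mule_ge0 ?poweR_ge0// lee_fin mulr_ge0 ?powR_ge0// ltW.
move=> t t0 tA.
have tn0 : (0 < t `^ n)%R by rewrite powR_gt0.
have tnA : (t `^ n)%:E < AVR m n x0.
  rewrite ltNge; apply/negP => At; move: tA; rewrite ltNge => /negP; apply.
  have -> : t%:E = ((t `^ n)%:E) `^ n^-1.
    by rewrite poweR_EFin -powRrM mulfV ?gt_eqF// powRr1// ltW.
  by apply: gt0_ler_poweR At; rewrite ?(ltW ni0)//= in_itv/= ?AVR_ge0 ?leey ?lee_fin ?powR_ge0.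
have [r1 growth] := AVR_growth w0 tn0 tnA.
have := sobolev_lsc mmsX n_gt1 CDX (mulr_gt0 tn0 w0) growth f1 lf f_f.
rewrite powRM ?powR_ge0 ?(ltW w0)// -powRrM mulfV ?gt_eqF// powRr1 ?(ltW t0)//.
by rewrite -/I -/q muleA -EFinM mulrCA.
Qed.

End avr.

Lemma cvg_L1_subset (R : realType) (X : completeMetricType R)
  (m : {measure set (borel X) -> \bar R}) (f_ : (X -> R)^nat) (f : X -> R)
  (K : set (borel X)) : measurable K -> L1 m f -> cvg_L1 m f_ f ->
  \int[m]_(x in K) `|f_ i x - f x|%:E @[i --> \oo] --> 0.
Proof.
move=> mK f1 [f_1 f_f]; apply: squeeze_cvge f_f; last exact: cvg_cst.
apply: nearW => i; rewrite integral_ge0//=; apply: ge0_subset_integral => //.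
apply/measurable_EFinP; apply: measurableT_comp => //.
apply: measurable_funB; apply/measurable_EFinP; [exact: measurable_int (f_1 i)|].
exact: measurable_int f1.
Qed.

Theorem theorem2p21 (R : realType) (X : completeMetricType R)
    (m : {measure set (borel X) -> \bar R}) (n : R)
    (n_gt1 : (1 < n)%R)
    (mmsX : metric_measure_space m)
    (CDX : CD0 m n)
    (x0 : X) :
  (forall f : X -> R, BV m f ->
    (n * omega n `^ n^-1)%:E * AVR m n x0 `^ n^-1 *
      (\int[m]_(x in [set: borel X]) (`|f x| `^ (n / (n - 1)))%:E)
        `^ ((n - 1) / n)
      <= bv_variation m f) /\
  (forall E : set (borel X), measurable E ->
    perimeter m E < +oo -> m E < +oo ->
    perimeter m E >=
      (n * omega n `^ n^-1)%:E * AVR m n x0 `^ n^-1 * m E `^ ((n - 1) / n)).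
Proof.
split=> [f [f1 _]|E mE _ mEoo].
  apply: le_ereal_inf_tmp => _ [f_ [lf cf ->]].
  apply: sobolev_AVR => // rho _; apply: cvg_L1_subset => //.
  by apply: closed_borel; exact: closed_mclosed_ball.
apply: le_ereal_inf_tmp => _ [u_ [lu cu ->]].
have E1 : L1 m \1_E.
  apply/integrableP; split; first exact/measurable_EFinP/measurable_indic.
  under eq_integral do rewrite /= ger0_norm//.
  by rewrite integral_indic// setIT.
have p0 : (n / (n - 1) != 0)%R.
  by rewrite mulf_neq0 ?invr_neq0 ?subr_eq0 ?gt_eqF// (lt_trans _ n_gt1).
have -> : m E = \int[m]_(x in [set: borel X]) (`|\1_E x : R| `^ (n / (n - 1)))%:E.
  rewrite -[in LHS](setIT E) -integral_indic//; apply: eq_integral => x _.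
  by rewrite indicE; case: (x \in E); rewrite ?normr1 ?powR1 ?normr0 ?powR0.
apply: sobolev_AVR => // rho rho0.
(* Local convergence is tested on compact sets, and closed balls are such sets. *)
by have [] := cu _ (@compact_mclosed_ball_CD0 _ _ _ mmsX _ CDX x0 rho).
Qed.
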